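(* Let $\mathbb{F}$ be an algebraically closed field of characteristic $0$, $n\ge2$ an integer and $\kappa\in\mathbb{F}\setminus\{0\}$. An $\mathbf{H}_\kappa$-module $M$ is in $\mathcal{O}^{ss}(\mathbf{H}_\kappa)$ if and only if $\widetilde{\mathbf{H}}_\kappa\otimes_{\mathbf{H}_\kappa}M$ is in $\mathcal{O}^{ss}(\widetilde{\mathbf{H}}_\kappa)$.
   Context: Notation: $\mathfrak{S}_n$ is the symmetric group, $s_{ij}$ the transposition of $i\ne j$, and $s_i=s_{i,i+1}$. Write $\mathbb{F}[\underline{x}]=\mathbb{F}[x_1,\dots,x_n]$, $\mathbb{F}[\underline{x}^{\pm1}]=\mathbb{F}[x_1^{\pm1},\dots,x_n^{\pm1}]$, $\mathbb{F}[\underline{y}]=\mathbb{F}[y_1,\dots,y_n]$, $\mathbb{F}[\underline{u}]=\mathbb{F}[u_1,\dots,u_n]$ (polynomial, resp. Laurent polynomial, rings). The group $\mathfrak{S}_n$ permutes the $x_i$, and $\rtimes$ denotes the smash product, so $wx_iw^{-1}=x_{w(i)}$. $\mathbf{H}_\kappa$ (rational Cherednik algebra of type $GL_n$) is the unital associative $\mathbb{F}$-algebra which is the quotient of the free product of the algebras $\mathbb{F}[\underline{x}]\rtimes\mathfrak{S}_n$ and $\mathbb{F}[\underline{y}]$ by the relations $s_iy_j=y_{s_i(j)}s_i$ ($1\le i\le n-1$, $1\le j\le n$); $[y_i,x_i]=\kappa+\sum_{k\ne i}s_{ik}$; $[y_i,x_j]=-s_{ij}$ for $i\neq j$. $\widetilde{\mathbf{H}}_\kappa$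 (degenerate double affine Hecke algebra of type $GL_n$) is the unital associative $\mathbb{F}$-algebra which is the quotient of the free product of the algebras $\mathbb{F}[\underline{x}^{\pm1}]\rtimes\mathfrak{S}_n$ and $\mathbb{F}[\underline{u}]$ by the relations $s_iu_i=u_{i+1}s_i-1$, $s_iu_{i+1}=u_is_i+1$ ($1\le i\le n-1$); $s_iu_j=u_js_i$ ($1\le i\le n-1$, $1\le j\le n$, $j\ne i,i+1$); $[u_i,x_i]=\kappa x_i+\sum_{1\le k<i}x_ks_{ki}+\sum_{i<k\le n}x_is_{ik}$; $[u_i,x_j]=-x_js_{ji}$ for $i>j$; $[u_i,x_j]=-x_is_{ij}$ for $i<j$. $\mathbf{H}_\kappa$ is regarded as a subalgebra of $\widetilde{\mathbf{H}}_\kappa$ via the injective algebra homomorphism $\iota$ with $\iota(w)=w$ ($w\in\mathfrak{S}_n$), $\iota(x_i)=x_i$, $\iota(y_i)=x_i^{-1}\big(u_i-\sum_{1\le j<i}s_{ji}\big)$; thus $u_i=x_iy_i+\sum_{1\le j<i}s_{ji}\in\mathbf{H}_\kappa$. $\mathcal{O}(\mathbf{H}_\kappa)$ is the full subcategory of the category of $\mathbf{H}_\kappa$-modules consisting of those modules that are finitely generated over $\mathbf{H}_\kappa$ and such that for every element $v$ there is $k>0$ with $y_i^kv=0$ for all $i$. $\mathcal{O}(\widetilde{\mathbf{H}}_\kappa)$ is the full subcategory of the category of $\widetilde{\mathbf{H}}_\kappa$-modules consisting of those modules $M$ that are finitely generated over $\widetilde{\mathbf{H}}_\kappa$ and satisfy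 $\dim\mathbb{F}[\underline{u}]v<\infty$ for every $v\in M$. For a module $M$ over either algebra and $\zeta=(\zeta_1,\dots,\zeta_n)\in\mathbb{F}^n$ put $M_\zeta=\{v\in M\mid u_iv=\zeta_iv\ \text{for all }i\}$. $\mathcal{O}^{ss}(\mathbf{H}_\kappa)$ (resp. $\mathcal{O}^{ss}(\widetilde{\mathbf{H}}_\kappa)$) is the full subcategory of $\mathcal{O}(\mathbf{H}_\kappa)$ (resp. $\mathcal{O}(\widetilde{\mathbf{H}}_\kappa)$) consisting of the $M$ with $M=\bigoplus_{\zeta\in\mathbb{F}^n}M_\zeta$.
   Formalization: The formal theorem assumes in addition that every v in M is killed by y_i^k for all i, for some k>0 (as for all M in O(H_κ)); for arbitrary M the ''if'' direction fails, e.g. for the module induced from the trivial F[x]⋊S_n-module with x_i acting by 0, whose further induction is 0. *)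

(* Defs.v *)
From HB Require Import structures.
From mathcomp Require Import all_boot all_order all_fingroup all_algebra.
From mathcomp Require Import finmap boolp.
From mathcomp Require Import xfinmap monalg.
Set Implicit Arguments.
Unset Strict Implicit.
Unset Printing Implicit Defensive.
Import GRing.Theory Quotient BigEnoughFSet.
Local Open Scope ring_scope.
Local Open Scope quotient_scope.

Section MalgLift.
Context (K : choiceType) (G W : zmodType) (f : K -> {additive G -> W}).

Definition malg_lift (g : {malg G[K]}) : W := \sum_(k <- msupp g) f k g@_k.

Lemma malg_liftEw (d : {fset K}) g :
  fsubset (msupp g) d -> malg_lift g = \sum_(k <- d) f k g@_k.
Proof.
move=> le; rewrite /malg_lift (big_fset_incl _ le) // => x _ /mcoeff_outdom ->.
by rewrite raddf0.
Qed.

Lemma malg_lift_is_additive : zmod_morphism malg_lift.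
Proof.
move=> g1 g2; pose_big_fset K E; rewrite 3?(malg_liftEw (d := E)) //.
  by rewrite -sumrB; apply/eq_bigr=> k _; rewrite mcoeffB raddfB.
by close.
Qed.

HB.instance Definition _ :=
  GRing.isZmodMorphism.Build {malg G[K]} W malg_lift malg_lift_is_additive.

Lemma malg_liftU c k : malg_lift (mkmalgU k c) = f k c.
Proof. by rewrite (malg_liftEw msuppU_le) big_seq_fset1 mcoeffUU. Qed.

End MalgLift.

Notation free_algebra F G := {malg F[{fmonom G}]}.

HB.lock Definition free_gen (F : fieldType) (G : choiceType) (g : G) :
  free_algebra F G := mkmalgU (fmu g) 1.
Arguments free_gen F {G} g.

Section FreeAlgebra.
Context (F : fieldType) (G : choiceType).
Local Notation free_alg := (free_algebra F G).

Lemma free_scalar_central (c : F) (a : free_alg) : c%:A * a = a * c%:A.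
Proof.
rewrite -scalerAl mul1r -[c%:A]mul_malgC mulr1.
rewrite [RHS]fgmulgU malgZ_def; apply/eq_bigr => k _.
by rewrite mulm1 mulrC.
Qed.

Context (B : pzRingType) (sc : {rmorphism F -> B}) (h : G -> B).

Definition eval_word (m : {fmonom G}) : B := \prod_(g <- (m : seq G)) h g.

Definition free_eval : free_alg -> B :=
  malg_lift (fun m => eval_word m \o* sc).
HB.instance Definition _ := GRing.Additive.on free_eval.

Lemma free_evalU m c : free_eval (mkmalgU m c) = sc c * eval_word m.
Proof. exact: malg_liftU. Qed.

Lemma eval_wordM m1 m2 :
  eval_word (mmul m1 m2) = eval_word m1 * eval_word m2.
Proof. by rewrite /eval_word fmM big_cat. Qed.

Lemma free_eval_scal c : free_eval c%:A = sc c.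
Proof.
rewrite -[c%:A]mul_malgC mulr1 free_evalU.
by rewrite /eval_word fm1 big_nil mulr1.
Qed.

Lemma free_eval_gen g : free_eval (free_gen F g) = h g.
Proof.
by rewrite free_gen.unlock free_evalU rmorph1 mul1r /eval_word fmU big_seq1.
Qed.

Lemma free_eval_monoid :
  (forall c b, sc c * b = b * sc c) -> monoid_morphism free_eval.
Proof.
move=> sc_central.
split=> [|a b]; first by rewrite -[X in free_eval X]scale1r free_eval_scal rmorph1.
have e x : free_eval x = \sum_(k <- msupp x) sc x@_k * eval_word k by [].
rewrite malgME raddf_sum /= [free_eval a]e [free_eval b]e mulr_suml.
apply: eq_bigr => i _; rewrite raddf_sum mulr_sumr /=; apply: eq_bigr => j _.
rewrite free_evalU rmorphM eval_wordM -!mulrA; congr (_ * _).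
by rewrite !mulrA sc_central.
Qed.

End FreeAlgebra.
(* MathComp's rings and algebras have [1 != 0] built in, except for the          *)
(* [pzRingType] level; presented algebras are therefore [pzRingType]s with a     *)
(* central ring morphism from the ground field.                                  *)
Section Presented.
Context (F : fieldType) (G : choiceType).
Local Notation free_alg := (free_algebra F G).

Variable R : free_alg -> free_alg -> Prop.

Inductive two_sided_ideal : free_alg -> Prop :=
| ideal_rel a b : R a b -> two_sided_ideal (a - b)
| ideal_zero : two_sided_ideal 0
| ideal_sub a b :
    two_sided_ideal a -> two_sided_ideal b -> two_sided_ideal (a - b)
| ideal_mull c a : two_sided_ideal a -> two_sided_ideal (c * a)
| ideal_mulr c a : two_sided_ideal a -> two_sided_ideal (a * c).

Definition ideal_pred (a : free_alg) : bool := `[< two_sided_ideal a >].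

Fact ideal_pred_closed : zmod_closed (ideal_pred : {pred free_alg}).
Proof.
split=> [|a b]; first exact/asboolP/ideal_zero.
by move=> /asboolP ha /asboolP hb; apply/asboolP/ideal_sub.
Qed.

HB.instance Definition _ :=
  GRing.isZmodClosed.Build free_alg ideal_pred ideal_pred_closed.

Definition ideal_closed : zmodClosed free_alg :=
  GRing.ZmodClosed.clone free_alg ideal_pred _.

Definition presented : Type := @quot free_alg ideal_closed.
HB.instance Definition _ := GRing.Zmodule.on presented.
HB.instance Definition _ : EqQuotient free_alg (@equiv free_alg ideal_closed) presented :=
  EqQuotient.on presented.

End Presented.

HB.lock Definition pres_pi (F : fieldType) (G : choiceType)
    (R : free_algebra F G -> free_algebra F G -> Prop)
    (a : free_algebra F G) : presented R := \pi_(presented R) a.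
Arguments pres_pi {F G} R a.

HB.lock Definition pres_one (F : fieldType) (G : choiceType)
    (R : free_algebra F G -> free_algebra F G -> Prop) : presented R :=
  pres_pi R 1.
Arguments pres_one {F G} R.

HB.lock Definition pres_mul (F : fieldType) (G : choiceType)
    (R : free_algebra F G -> free_algebra F G -> Prop)
    (a b : presented R) : presented R :=
  pres_pi R (generic_quotient.repr a * generic_quotient.repr b).
Arguments pres_mul {F G R} a b.

Section PresentedAlgebra.
Context (F : fieldType) (G : choiceType).
Local Notation free_alg := (free_algebra F G).
Context (R : free_alg -> free_alg -> Prop).
Local Notation presented := (presented R).
Local Notation pres_pi := (pres_pi R).
Local Notation pres_one := (pres_one R).
Local Notation pres_mul := (@pres_mul F G R).
Local Notation two_sided_ideal := (two_sided_ideal R).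
Local Notation ideal_closed := (ideal_closed R).

Definition pres_repr : presented -> free_alg := @generic_quotient.repr _ presented.

Lemma pres_reprK : cancel pres_repr pres_pi.
Proof. by move=> a; rewrite pres_pi.unlock; apply: reprK. Qed.

Lemma pres_piP a b : pres_pi a = pres_pi b <-> two_sided_ideal (a - b).
Proof.
rewrite (rwP eqP) pres_pi.unlock -[_ == _]idealrBE; split; first by move/asboolP.
by move=> h; apply/asboolP.
Qed.

Fact pres_pi_zmod : zmod_morphism pres_pi.
Proof. by move=> a b; rewrite pres_pi.unlock raddfB. Qed.

Fact pres_pi_mul a b : pres_pi (a * b) = pres_mul (pres_pi a) (pres_pi b).
Proof.
rewrite pres_mul.unlock; apply/pres_piP.
set a' := generic_quotient.repr _; set b' := generic_quotient.repr _.
have -> : a * b - a' * b' = (a - a') * b - a' * (b' - b).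
  by rewrite mulrBl mulrBr opprB addrA subrK.
apply: ideal_sub; [apply: ideal_mulr|apply: ideal_mull]; apply/pres_piP;
  by rewrite pres_reprK.
Qed.

Let presW (P : presented -> Prop) : (forall a, P (pres_pi a)) -> forall a, P a.
Proof. by move=> h a; rewrite -[a]pres_reprK. Qed.

Fact pres_mulA : associative pres_mul.
Proof.
by elim/presW=> a; elim/presW=> b; elim/presW=> c; rewrite -!pres_pi_mul mulrA.
Qed.
Fact pres_mul1 : left_id pres_one pres_mul.
Proof. by elim/presW=> a; rewrite pres_one.unlock -pres_pi_mul mul1r. Qed.
Fact pres_1mul : right_id pres_one pres_mul.
Proof. by elim/presW=> a; rewrite pres_one.unlock -pres_pi_mul mulr1. Qed.
Let pi_add a b : pres_pi (a + b) = pres_pi a + pres_pi b.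
Proof. by rewrite pres_pi.unlock raddfD. Qed.
Fact pres_mulDl : left_distributive pres_mul +%R.
Proof.
elim/presW=> a; elim/presW=> b; elim/presW=> c.
by rewrite -pi_add -!pres_pi_mul -pi_add mulrDl.
Qed.
Fact pres_mulDr : right_distributive pres_mul +%R.
Proof.
elim/presW=> a; elim/presW=> b; elim/presW=> c.
by rewrite -pi_add -!pres_pi_mul -pi_add mulrDr.
Qed.

HB.instance Definition _ := GRing.Zmodule_isPzRing.Build presented
  pres_mulA pres_mul1 pres_1mul pres_mulDl pres_mulDr.

HB.instance Definition _ :=
  GRing.isZmodMorphism.Build free_alg presented pres_pi pres_pi_zmod.

Fact pres_pi_monoid : monoid_morphism pres_pi.
Proof. by split; [rewrite -[RHS]/pres_one pres_one.unlock|exact: pres_pi_mul]. Qed.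
HB.instance Definition _ :=
  GRing.isMonoidMorphism.Build free_alg presented pres_pi pres_pi_monoid.

Definition pres_gen (g : G) : presented := pres_pi (free_gen F g).

Definition pres_scal (c : F) : presented := pres_pi (c%:A).
Lemma pres_pi1 : pres_pi 1 = 1. Proof. exact: rmorph1. Qed.
Lemma pres_piD a b : pres_pi (a + b) = pres_pi a + pres_pi b.
Proof. exact: raddfD. Qed.
Lemma pres_piN a : pres_pi (- a) = - pres_pi a.
Proof. exact: raddfN. Qed.
Lemma pres_piB a b : pres_pi (a - b) = pres_pi a - pres_pi b.
Proof. exact: raddfB. Qed.
Lemma pres_piM a b : pres_pi (a * b) = pres_pi a * pres_pi b.
Proof. exact: rmorphM. Qed.
Lemma pres_pi_sum (I : finType) (P : pred I) (E : I -> free_alg) :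
  pres_pi (\sum_(i | P i) E i) = \sum_(i | P i) pres_pi (E i).
Proof. exact: raddf_sum. Qed.
Lemma pres_pi_gen g : pres_pi (free_gen F g) = pres_gen g.
Proof. by []. Qed.
Lemma pres_piZ c a : pres_pi (c *: a) = pres_scal c * pres_pi a.
Proof. by rewrite /pres_scal -pres_piM -scalerAl mul1r. Qed.

Fact pres_scal_zmod : zmod_morphism pres_scal.
Proof. by move=> a b; rewrite /pres_scal scalerBl rmorphB. Qed.
Fact pres_scal_monoid : monoid_morphism pres_scal.
Proof.
split=> [|a b]; first by rewrite /pres_scal scale1r rmorph1.
by rewrite /pres_scal -scalerA -rmorphM -scalerAl mul1r.
Qed.
HB.instance Definition _ :=
  GRing.isZmodMorphism.Build F presented pres_scal pres_scal_zmod.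
HB.instance Definition _ :=
  GRing.isMonoidMorphism.Build F presented pres_scal pres_scal_monoid.

Lemma pres_scal_central c (a : presented) : pres_scal c * a = a * pres_scal c.
Proof.
by elim/presW: a => a; rewrite /pres_scal -!rmorphM free_scalar_central.
Qed.

Lemma pres_relP a b : R a b -> pres_pi a = pres_pi b.
Proof. by move=> h; apply/pres_piP/ideal_rel. Qed.

Lemma pres_relMM a b c d : R (a * b) (c * d) ->
  pres_pi a * pres_pi b = pres_pi c * pres_pi d.
Proof. by move/pres_relP; rewrite (pres_piM a b) (pres_piM c d). Qed.

Lemma pres_relM a b c : R (a * b) c -> pres_pi a * pres_pi b = pres_pi c.
Proof. by move/pres_relP; rewrite pres_piM. Qed.

Lemma pres_relC a b c d e : R (a * b - c * d) e ->
  pres_pi a * pres_pi b - pres_pi c * pres_pi d = pres_pi e.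
Proof.
by move/pres_relP; rewrite pres_piB (pres_piM a b) (pres_piM c d).
Qed.

Section Lift.
Context (B : pzRingType) (sc : {rmorphism F -> B}) (h : G -> B).

(* The hypotheses are arguments, so that [pres_lift] is canonically a ring       *)
(* morphism.                                                                     *)
Definition pres_lift of (forall c b, sc c * b = b * sc c)
    & (forall a b, R a b -> free_eval sc h a = free_eval sc h b) :
    presented -> B :=
  fun a => free_eval sc h (pres_repr a).

Context (sc_central : forall c b, sc c * b = b * sc c).
Context (h_rel : forall a b, R a b -> free_eval sc h a = free_eval sc h b).
Local Notation lift := (pres_lift sc_central h_rel).

Lemma free_eval_ideal a : two_sided_ideal a -> free_eval sc h a = 0.
Proof.
have [_ hM] := free_eval_monoid h sc_central.
elim=> [x y /h_rel hxy||x y _ hx _ hy|c x _ hx|c x _ hx].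
- by rewrite raddfB /= hxy subrr.
- by rewrite raddf0.
- by rewrite raddfB /= hx hy subrr.
- by rewrite hM hx mulr0.
- by rewrite hM hx mul0r.
Qed.

Lemma pres_lift_pi a : lift (pres_pi a) = free_eval sc h a.
Proof.
apply/eqP; rewrite -subr_eq0 -raddfB; apply/eqP/free_eval_ideal/pres_piP.
by rewrite pres_reprK.
Qed.

Fact pres_lift_zmod : zmod_morphism lift.
Proof.
by elim/presW=> a; elim/presW=> b; rewrite -raddfB !pres_lift_pi raddfB.
Qed.

Fact pres_lift_monoid : monoid_morphism lift.
Proof.
have [h1 hM] := free_eval_monoid h sc_central.
split; first by rewrite -(rmorph1 pres_pi) pres_lift_pi h1.
by elim/presW=> a; elim/presW=> b; rewrite -rmorphM !pres_lift_pi hM.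
Qed.

HB.instance Definition _ :=
  GRing.isZmodMorphism.Build presented B lift pres_lift_zmod.
HB.instance Definition _ :=
  GRing.isMonoidMorphism.Build presented B lift pres_lift_monoid.

Lemma pres_lift_gen g : lift (pres_gen g) = h g.
Proof. by rewrite pres_lift_pi free_eval_gen. Qed.

Lemma pres_lift_scal c : lift (pres_scal c) = sc c.
Proof. by rewrite pres_lift_pi free_eval_scal. Qed.

End Lift.
End PresentedAlgebra.

Section TensorProduct.
Context (A B : pzRingType) (f : {rmorphism A -> B}) (M : lmodType A).
Local Notation formal := {malg int[(B * M)%type]}.

Definition formal_tensor (b : B) (m : M) : formal := mkmalgU (b, m) 1.
Local Notation "b ** m" := (formal_tensor b m) (at level 40).

(* The tensor product is the free abelian group on B x M modulo [tensor_null].   *)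
Inductive tensor_null : formal -> Prop :=
| tensor_null_addl b b' m : tensor_null ((b + b') ** m - (b ** m + b' ** m))
| tensor_null_addr b m m' : tensor_null (b ** (m + m') - (b ** m + b ** m'))
| tensor_null_bal b a m : tensor_null ((b * f a) ** m - b ** (a *: m))
| tensor_null_zero : tensor_null 0
| tensor_null_sub t t' : tensor_null t -> tensor_null t' -> tensor_null (t - t').

Definition tensor_pred (t : formal) : bool := `[< tensor_null t >].

Fact tensor_pred_closed : zmod_closed (tensor_pred : {pred formal}).
Proof.
split=> [|a b]; first exact/asboolP/tensor_null_zero.
by move=> /asboolP ha /asboolP hb; apply/asboolP/tensor_null_sub.
Qed.
HB.instance Definition _ :=
  GRing.isZmodClosed.Build formal tensor_pred tensor_pred_closed.
Definition tensor_closed : zmodClosed formal :=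
  GRing.ZmodClosed.clone formal tensor_pred _.

Definition tensor : Type := @quot formal tensor_closed.
HB.instance Definition _ := GRing.Zmodule.on tensor.
HB.instance Definition _ : EqQuotient formal (@equiv formal tensor_closed) tensor :=
  EqQuotient.on tensor.

Definition tensor_pi : formal -> tensor := \pi_tensor.
Definition tensor_repr : tensor -> formal := @generic_quotient.repr _ tensor.

Lemma tensor_reprK : cancel tensor_repr tensor_pi. Proof. exact: reprK. Qed.

Lemma tensor_piP a b : tensor_pi a = tensor_pi b <-> tensor_null (a - b).
Proof.
rewrite (rwP eqP) /tensor_pi -[_ == _]idealrBE; split; first by move/asboolP.
by move=> h; apply/asboolP.
Qed.

Fact tensor_pi_zmod : zmod_morphism tensor_pi.
Proof. by move=> a b; rewrite /tensor_pi raddfB. Qed.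
HB.instance Definition _ :=
  GRing.isZmodMorphism.Build formal tensor tensor_pi tensor_pi_zmod.

Definition formal_act (b : B) : formal -> formal :=
  malg_lift (fun k => *~%R (b * k.1 ** k.2)).
HB.instance Definition _ b := GRing.Additive.on (formal_act b).

Lemma formal_actE b c m : formal_act b (c ** m) = (b * c) ** m.
Proof. by rewrite /formal_act malg_liftU. Qed.

Lemma formal_act_null b t : tensor_null t -> tensor_null (formal_act b t).
Proof.
elim=> [c c' m|c m m'|c a m||t1 t2 _ h1 _ h2].
- by rewrite raddfB raddfD /= !formal_actE mulrDr; apply: tensor_null_addl.
- by rewrite raddfB raddfD /= !formal_actE; apply: tensor_null_addr.
- by rewrite raddfB /= !formal_actE mulrA; apply: tensor_null_bal.
- by rewrite raddf0; apply: tensor_null_zero.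
- by rewrite raddfB; apply: tensor_null_sub.
Qed.

Definition tensor_scale (b : B) (t : tensor) : tensor :=
  tensor_pi (formal_act b (tensor_repr t)).

Lemma tensor_scale_pi b t :
  tensor_scale b (tensor_pi t) = tensor_pi (formal_act b t).
Proof.
apply/tensor_piP; rewrite -raddfB; apply/formal_act_null/tensor_piP.
by rewrite tensor_reprK.
Qed.

Definition tens (b : B) (m : M) : tensor := tensor_pi (b ** m).

Lemma tensor_scale_tens b c m : tensor_scale b (tens c m) = tens (b * c) m.
Proof. by rewrite tensor_scale_pi formal_actE. Qed.

Lemma tensor_ind (P : tensor -> Prop) :
  (forall b m, P (tens b m)) -> P 0 -> (forall t t', P t -> P t' -> P (t - t')) ->
  forall t, P t.
Proof.
move=> hU h0 hB t; rewrite -[t]tensor_reprK [tensor_repr t]monalgE raddf_sum.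
have hN t' : P t' -> P (- t') by move=> ?; rewrite -sub0r; apply: hB.
have hD t1 t2 : P t1 -> P t2 -> P (t1 + t2).
  by move=> ? ?; rewrite -[t2]opprK; apply/hB/hN.
elim/big_ind: _ => // -[b m] _ /=.
have hMn k : P (tens b m *+ k).
  by elim: k => // k ?; rewrite mulrS; apply: hD.
have -> : tensor_pi (mkmalgU (b, m) (tensor_repr t)@_(b, m)) =
    tens b m *~ (tensor_repr t)@_(b, m).
  rewrite /tens -raddfMz /formal_tensor; congr tensor_pi.
  by rewrite -raddfMz intz.
by case: (_@_(b, m)) => k; [apply: hMn|apply: hN; apply: hMn].
Qed.

Lemma tensDl b b' m : tens (b + b') m = tens b m + tens b' m.
Proof. by rewrite /tens -raddfD; apply/tensor_piP/tensor_null_addl. Qed.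
Lemma tensDr b m m' : tens b (m + m') = tens b m + tens b m'.
Proof. by rewrite /tens -raddfD; apply/tensor_piP/tensor_null_addr. Qed.
Lemma tens_bal b a m : tens (b * f a) m = tens b (a *: m).
Proof. exact/tensor_piP/tensor_null_bal. Qed.

Fact tensor_scaleBr b : zmod_morphism (tensor_scale b).
Proof.
move=> t t'; rewrite -[t]tensor_reprK -[t']tensor_reprK -raddfB.
by rewrite !tensor_scale_pi !raddfB.
Qed.
Fact tensor_scale0r b : tensor_scale b 0 = 0.
Proof.
by have := tensor_scaleBr b 0 0; rewrite (subrr (0 : tensor)) subrr.
Qed.
Fact tensor_scaleDr : right_distributive tensor_scale +%R.
Proof.
move=> b t t'; rewrite -[t]tensor_reprK -[t']tensor_reprK -raddfD.
by rewrite !tensor_scale_pi !raddfD.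
Qed.
Fact tensor_scaleA a b t :
  tensor_scale a (tensor_scale b t) = tensor_scale (a * b) t.
Proof.
elim/tensor_ind: t => [c m||t t' h h'].
- by rewrite !tensor_scale_tens mulrA.
- by rewrite !tensor_scale0r.
- by rewrite !tensor_scaleBr h h'.
Qed.
Fact tensor_scale1 : left_id 1 tensor_scale.
Proof.
elim/tensor_ind=> [c m||t t' h h'].
- by rewrite tensor_scale_tens mul1r.
- by rewrite tensor_scale0r.
- by rewrite tensor_scaleBr h h'.
Qed.
Fact tensor_scaleDl t : {morph tensor_scale^~ t : a b / a + b}.
Proof.
move=> a b /=; elim/tensor_ind: t => [c m||t t' h h'].
- by rewrite !tensor_scale_tens mulrDl tensDl.
- by rewrite !tensor_scale0r addr0.
- by rewrite !tensor_scaleBr h h' opprD addrACA.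
Qed.

HB.instance Definition _ := GRing.Zmodule_isLmodule.Build B tensor
  tensor_scaleA tensor_scale1 tensor_scaleDr tensor_scaleDl.

End TensorProduct.

Lemma commutator_aux (R : pzRingType) (a b c d e f : R) :
  (a + c) * (b + d) = (b + d) * (a + c) -> c * b = b * c -> c * d = d * c ->
  d * a = a * d - e + f -> a * b - b * a = f - e.
Proof.
move=> + cb cd da; rewrite !mulrDl !mulrDr cb cd [X in _ = X]addrACA.
move/addIr => h; apply: (addIr (a * d)).
by rewrite addrAC h da [b * a + _]addrC addrK -addrA addrC [- e + f]addrC.
Qed.

Section CherednikAlgebras.
Context (F : fieldType) (n : nat).
Implicit Types (i j k : 'I_n) (v w : {perm 'I_n}) (kappa : F).

Definition rca_gens : Type := 'I_n + 'I_n + {perm 'I_n}.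
HB.instance Definition _ := Choice.on rca_gens.

Definition rca_x i : rca_gens := inl (inl i).
Definition rca_y i : rca_gens := inl (inr i).
Definition rca_w w : rca_gens := inr w.

Section RationalRelations.
Let X i := free_gen F (rca_x i).
Let Y i := free_gen F (rca_y i).
Let W w := free_gen F (rca_w w).
Let S i j := W (tperm i j).

(* The smash product F[x] # S_n is presented by the [x i] and all permutations.  *)
(* In MathComp [(w * v)%g] is [w] followed by [v], i.e. the function v \o w.     *)
Inductive rca_rel kappa : free_algebra F rca_gens -> free_algebra F rca_gens -> Prop :=
| rca_xx i j : rca_rel kappa (X i * X j) (X j * X i)
| rca_w1 : rca_rel kappa (W 1%g) 1
| rca_ww v w : rca_rel kappa (W v * W w) (W (w * v)%g)
| rca_wx w i : rca_rel kappa (W w * X i) (X (w i) * W w)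
| rca_yy i j : rca_rel kappa (Y i * Y j) (Y j * Y i)
| rca_sy i i' j : i' = i.+1 :> nat ->
    rca_rel kappa (S i i' * Y j) (Y (tperm i i' j) * S i i')
| rca_yx_eq i :
    rca_rel kappa (Y i * X i - X i * Y i) (kappa%:A + \sum_(k : 'I_n | k != i) S i k)
| rca_yx_neq i j : i != j ->
    rca_rel kappa (Y i * X j - X j * Y i) (- S i j).
End RationalRelations.

Definition rca kappa : Type := presented (rca_rel kappa).
HB.instance Definition _ kappa := GRing.PzRing.on (rca kappa).

Definition tca_gens : Type := 'I_n + 'I_n + 'I_n + {perm 'I_n}.
HB.instance Definition _ := Choice.on tca_gens.

Definition tca_x i : tca_gens := inl (inl (inl i)).
Definition tca_xV i : tca_gens := inl (inl (inr i)).
Definition tca_u i : tca_gens := inl (inr i).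
Definition tca_w w : tca_gens := inr w.

Section TrigonometricRelations.
Let X i := free_gen F (tca_x i).
Let XV i := free_gen F (tca_xV i).
Let U i := free_gen F (tca_u i).
Let W w := free_gen F (tca_w w).
Let S i j := W (tperm i j).

(* The relations make each [XV i] commute with every [X j] and [XV j], and give  *)
(* w x_i^-1 w^-1 = x_(w i)^-1.                                                   *)
Inductive tca_rel kappa : free_algebra F tca_gens -> free_algebra F tca_gens -> Prop :=
| tca_xx i j : tca_rel kappa (X i * X j) (X j * X i)
| tca_xxV i : tca_rel kappa (X i * XV i) 1
| tca_xVx i : tca_rel kappa (XV i * X i) 1
| tca_w1 : tca_rel kappa (W 1%g) 1
| tca_ww v w : tca_rel kappa (W v * W w) (W (w * v)%g)
| tca_wx w i : tca_rel kappa (W w * X i) (X (w i) * W w)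
| tca_uu i j : tca_rel kappa (U i * U j) (U j * U i)
| tca_su i i' : i' = i.+1 :> nat ->
    tca_rel kappa (S i i' * U i) (U i' * S i i' - 1)
| tca_su' i i' : i' = i.+1 :> nat ->
    tca_rel kappa (S i i' * U i') (U i * S i i' + 1)
| tca_su_neq i i' j : i' = i.+1 :> nat -> j != i -> j != i' ->
    tca_rel kappa (S i i' * U j) (U j * S i i')
| tca_ux_eq i :
    tca_rel kappa (U i * X i - X i * U i)
      (kappa *: X i + \sum_(k : 'I_n | (k < i)%N) X k * S k i
                    + \sum_(k : 'I_n | (i < k)%N) X i * S i k)
| tca_ux_gt i j : (j < i)%N ->
    tca_rel kappa (U i * X j - X j * U i) (- (X j * S j i))
| tca_ux_lt i j : (i < j)%N ->
    tca_rel kappa (U i * X j - X j * U i) (- (X i * S i j)).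
End TrigonometricRelations.

Definition tca kappa : Type := presented (tca_rel kappa).
HB.instance Definition _ kappa := GRing.PzRing.on (tca kappa).

Section Generators.
Context (kappa : F).

Definition Hx i : rca kappa := pres_gen _ (rca_x i).
Definition Hy i : rca kappa := pres_gen _ (rca_y i).
Definition Hw w : rca kappa := pres_gen _ (rca_w w).
Definition Hu i : rca kappa :=
  Hx i * Hy i + \sum_(j : 'I_n | (j < i)%N) Hw (tperm j i).

Definition tHx i : tca kappa := pres_gen _ (tca_x i).
Definition tHxV i : tca kappa := pres_gen _ (tca_xV i).
Definition tHu i : tca kappa := pres_gen _ (tca_u i).
Definition tHw w : tca kappa := pres_gen _ (tca_w w).
(* The image of [Hy i] under the embedding.                                      *)
Definition tHy i : tca kappa :=
  tHxV i * (tHu i - \sum_(j : 'I_n | (j < i)%N) tHw (tperm j i)).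
End Generators.

Section Embedding.
Context (kappa : F).
Local Notation x := (@tHx kappa).
Local Notation xV := (@tHxV kappa).
Local Notation u := (@tHu kappa).
Local Notation w_ := (@tHw kappa).
Local Notation y := (@tHy kappa).
Local Notation sc := (pres_scal (tca_rel kappa)).
Let s i j : tca kappa := w_ (tperm i j).
Let U i : tca kappa := locked (u i - \sum_(j : 'I_n | (j < i)%N) s j i).
Let UE i : U i = u i - \sum_(j : 'I_n | (j < i)%N) s j i.
Proof. by rewrite /U -lock. Qed.

Let xx i j : x i * x j = x j * x i.
Proof. exact: pres_relMM (tca_xx kappa i j). Qed.
Let xxV i : x i * xV i = 1.
Proof. by rewrite (pres_relM (tca_xxV kappa i)) pres_pi1. Qed.
Let xVx i : xV i * x i = 1.
Proof. by rewrite (pres_relM (tca_xVx kappa i)) pres_pi1. Qed.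
Let w1 : w_ 1%g = 1.
Proof. by rewrite /tHw /pres_gen (pres_relP (tca_w1 kappa)) pres_pi1. Qed.
Let ww v w : w_ v * w_ w = w_ (w * v)%g.
Proof. exact: pres_relM (tca_ww kappa v w). Qed.
Let wx w i : w_ w * x i = x (w i) * w_ w.
Proof. exact: pres_relMM (tca_wx kappa w i). Qed.
Let uu i j : u i * u j = u j * u i.
Proof. exact: pres_relMM (tca_uu kappa i j). Qed.
Let su i i' : i' = i.+1 :> nat -> s i i' * u i = u i' * s i i' - 1.
Proof.
by move=> h; rewrite (pres_relM (tca_su kappa h)) pres_piB pres_piM pres_pi1.
Qed.
Let su' i i' : i' = i.+1 :> nat -> s i i' * u i' = u i * s i i' + 1.
Proof.
by move=> h; rewrite (pres_relM (tca_su' kappa h)) pres_piD pres_piM pres_pi1.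
Qed.
Let su_neq i i' j : i' = i.+1 :> nat -> j != i -> j != i' ->
  s i i' * u j = u j * s i i'.
Proof. by move=> h h1 h2; exact: pres_relMM (tca_su_neq kappa h h1 h2). Qed.
Let ux_eq i : u i * x i - x i * u i =
  sc kappa * x i + \sum_(k : 'I_n | (k < i)%N) x k * s k i
    + \sum_(k : 'I_n | (i < k)%N) x i * s i k.
Proof.
rewrite (pres_relC (tca_ux_eq kappa i)).
apply: etrans (pres_piD _ _ _) _; congr (_ + _); last first.
  by rewrite pres_pi_sum; apply: eq_bigr => k _; apply: pres_piM.
apply: etrans (pres_piD _ _ _) _; congr (_ + _); first exact: pres_piZ.
by rewrite pres_pi_sum; apply: eq_bigr => k _; apply: pres_piM.
Qed.
Let ux_gt i j : (j < i)%N -> u i * x j - x j * u i = - (x j * s j i).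
Proof.
by move=> h; rewrite (pres_relC (tca_ux_gt kappa h)) pres_piN pres_piM.
Qed.
Let ux_lt i j : (i < j)%N -> u i * x j - x j * u i = - (x i * s i j).
Proof.
by move=> h; rewrite (pres_relC (tca_ux_lt kappa h)) pres_piN pres_piM.
Qed.

Let ss i j : s i j * s i j = 1. Proof. by rewrite /s ww tperm2 w1. Qed.
Let sC i j : s i j = s j i. Proof. by rewrite /s tpermC. Qed.
Let ws w i j : w_ w * s i j = s (w i) (w j) * w_ w.
Proof. by rewrite /s !ww -tpermJ conjgE !mulgA mulgV mul1g. Qed.

Let xxV_comm i j : x i * xV j = xV j * x i.
Proof.
by rewrite -[LHS]mul1r -(xVx j) -!mulrA [x j * _]mulrA -xx -mulrA xxV mulr1.
Qed.
Let xVxV i j : xV i * xV j = xV j * xV i.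
Proof.
rewrite -[RHS]mul1r -(xVx i) -mulrA [x i * _]mulrA xxV_comm -!mulrA xxV mulr1.
by [].
Qed.
Let wxV w i : w_ w * xV i = xV (w i) * w_ w.
Proof.
rewrite -[LHS]mul1r -(xVx (w i)) -[LHS]mulrA [x _ * (_ * _)]mulrA -wx.
by rewrite -[w_ w * x i * _]mulrA xxV mulr1.
Qed.

Let wU_simple i i' j : i' = i.+1 :> nat ->
  s i i' * U j = U (tperm i i' j) * s i i'.
Proof.
move=> hi.
have hU : s i i' * U i = U i' * s i i'.
  rewrite !UE mulrBr mulrBl su // (bigD1 (P := fun k : 'I_n => (k < i')%N) i) /=;
    last by rewrite hi.
  rewrite mulrDl ss opprD addrA; congr (_ - _).
  rewrite mulr_sumr mulr_suml; apply: eq_big => k.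
    by rewrite hi ltnS ltn_neqAle andbC.
  move=> hk; rewrite ws tpermL tpermD //; apply: contraTneq hk => <-.
    by rewrite ltnn.
  by rewrite -leqNgt hi.
have [->|ji] := eqVneq j i; first by rewrite tpermL.
have [->|ji'] := eqVneq j i'.
  by rewrite tpermR -[U i']mulr1 -(ss i i') [U i' * _]mulrA -hU !mulrA ss mul1r.
rewrite tpermD 1?eq_sym // !UE mulrBr mulrBl su_neq //; congr (_ - _).
rewrite mulr_sumr mulr_suml (reindex_inj (@perm_inj _ (tperm i i'))) /=.
apply: eq_big => k; last first.
  by move=> _; rewrite ws tpermK [tperm i i' j]tpermD // eq_sym.
have e : (i' < j)%N = (i < j)%N.
  by rewrite -[RHS]/(i.+1 <= j)%N -hi ltn_neqAle val_eqE eq_sym ji'.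
by case: tpermP => [->|->|].
Qed.

Let commU := fun w => forall j, w_ w * U j = U (w j) * w_ w.

Let commUM v w : commU v -> commU w -> commU (w * v)%g.
Proof.
by move=> hv hw j; rewrite -ww -mulrA hw mulrA hv -mulrA permM.
Qed.

Let sU_lt d i j : (i + d.+1)%N = j -> commU (tperm i j).
Proof.
elim: d j => [|d IHd] j hj.
  by move=> k; apply: wU_simple; rewrite -hj addn1.
have hj' : (i + d.+1 < n)%N by rewrite -ltnS -addnS hj ltnW ?ltnS.
pose j' : 'I_n := Ordinal hj'.
have jj' : j = j'.+1 :> nat by rewrite -hj addnS.
have hs : commU (tperm j' j) by move=> k; apply: wU_simple.
have -> : tperm i j = (tperm j' j * (tperm i j' * tperm j' j))%g.
  rewrite -[X in (X * _)%g]tpermV -conjgE tpermJ tpermL tpermD //.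
    by rewrite -val_eqE /= -[X in _ != X]addn0 eqn_add2l.
  by rewrite -val_eqE /= -hj -[X in _ != X]addn0 eqn_add2l.
by do 2!apply: commUM => //; apply: IHd.
Qed.

Let sU i j k : s i j * U k = U (tperm i j k) * s i j.
Proof.
case: (ltngtP i j) => [ij|ji|/val_inj->].
- by apply: (sU_lt (d := j - i.+1)); rewrite addnS -addSn subnKC.
- rewrite /s tpermC; apply: (sU_lt (d := i - j.+1)).
  by rewrite addnS -addSn subnKC.
- by rewrite /s tperm1 w1 mul1r mulr1 perm1.
Qed.

Let UU i j : (i < j)%N -> U i * U j - U j * U i = (U j - U i) * s i j.
Proof.
move=> ij.
pose A k := \sum_(l : 'I_n | (l < k)%N) s l k.
have uE k : u k = U k + A k by rewrite UE subrK.
have nij : i != j by rewrite neq_ltn ij.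
have AU : A i * U j = U j * A i.
  rewrite mulr_suml mulr_sumr; apply: eq_bigr => k ki.
  by rewrite sU tpermD // neq_ltn ?(ltn_trans ki ij).
have AA : A i * A j = A j * A i.
  rewrite mulr_suml mulr_sumr; apply: eq_bigr => k ki.
  have kj := ltn_trans ki ij.
  rewrite mulr_sumr mulr_suml (reindex_inj (@perm_inj _ (tperm k i))) /=.
  apply: eq_big => l.
    by case: tpermP => [->|->|]; rewrite ?ij ?kj.
  by move=> _; rewrite ws tpermK tpermD // neq_ltn ?ij ?kj.
pose C := \sum_(k : 'I_n | (k < j)%N && (k != i)) s k j.
have AjE : A j = s i j + C by rewrite /A (bigD1 i).
have CU : C * U i = U i * C.
  rewrite mulr_suml mulr_sumr; apply: eq_bigr => k /andP[kj ki].
  by rewrite sU tpermD // neq_ltn ij orbT.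
have AUj : A j * U i = U i * A j - U i * s i j + U j * s i j.
  rewrite AjE (mulrDl _ _ (U i)) (mulrDr (U i) (s i j)) sU tpermL CU.
  by rewrite [_ + _ - _]addrAC subrr add0r addrC.
rewrite [RHS]mulrBl; apply: (commutator_aux _ AU AA AUj); first by rewrite -!uE uu.
Qed.

Let sx i j k : s i j * x k = x (tperm i j k) * s i j.
Proof. exact: wx. Qed.

Let A i := \sum_(k : 'I_n | (k < i)%N) s k i.

Let UxE i j : U i * x j - x j * U i =
  (u i * x j - x j * u i) - (A i * x j - x j * A i).
Proof. by rewrite UE mulrBl mulrBr !opprD !opprK addrACA. Qed.

Let AxE i j : A i * x j - x j * A i =
  \sum_(k : 'I_n | (k < i)%N) (s k i * x j - x j * s k i).
Proof. by rewrite mulr_suml mulr_sumr -sumrB. Qed.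

Let Ux_neq i j : i != j -> U i * x j - x j * U i = - (x i * s i j).
Proof.
move=> nij; rewrite UxE AxE.
have h k : k != i -> k != j -> s k i * x j - x j * s k i = 0.
  by move=> ki kj; rewrite sx tpermD ?subrr // eq_sym.
move: (nij); rewrite neq_ltn => /orP[ij|ji].
  rewrite ux_lt // big1 ?subr0 // => k ki.
  by apply: h; rewrite neq_ltn ?ki ?(ltn_trans ki ij).
rewrite ux_gt // (bigD1 j) //= big1 ?addr0; last first.
  by move=> k /andP[ki kj]; apply: h => //; rewrite neq_ltn ki.
by rewrite sx tpermL opprB addrCA addrA subrr add0r sC.
Qed.

Let Ux_eq i : U i * x i - x i * U i =
  sc kappa * x i + \sum_(k : 'I_n | k != i) x i * s i k.
Proof.
rewrite UxE AxE ux_eq (bigID (fun k : 'I_n => (k < i)%N) (fun k => k != i)) /=.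
have e1 : \sum_(k : 'I_n | (k < i)%N) (s k i * x i - x i * s k i) =
    \sum_(k : 'I_n | (k < i)%N) x k * s k i
    - \sum_(k : 'I_n | (k < i)%N) x i * s i k.
  rewrite -sumrB; apply: eq_bigr => k _.
  by rewrite sx tpermR [s i k]sC.
have e2 : \sum_(k : 'I_n | (k != i) && (k < i)%N) x i * s i k =
    \sum_(k : 'I_n | (k < i)%N) x i * s i k.
  by apply: eq_bigl => k; rewrite -val_eqE neq_ltn; case: ltngtP.
have e3 : \sum_(k : 'I_n | (k != i) && ~~ (k < i)%N) x i * s i k =
    \sum_(k : 'I_n | (i < k)%N) x i * s i k.
  by apply: eq_bigl => k; rewrite -val_eqE neq_ltn; case: ltngtP.
rewrite e1 e2 e3 opprB -!addrA; congr (_ + _).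
by rewrite addrC -!addrA addNr addr0 addrC.
Qed.

Let yE i : y i = xV i * U i. Proof. by rewrite UE. Qed.

Lemma tHwy i i' j : i' = i.+1 :> nat -> s i i' * y j = y (tperm i i' j) * s i i'.
Proof. by move=> h; rewrite !yE mulrA wxV -!mulrA sU. Qed.

Lemma tHyx_eq i : y i * x i - x i * y i = sc kappa + \sum_(k : 'I_n | k != i) s i k.
Proof.
have -> : x i * y i = y i * x i - xV i * (U i * x i - x i * U i).
  by rewrite mulrBr yE !mulrA xVx xxV mul1r opprB addrCA subrr addr0.
rewrite opprB addrCA subrr addr0 Ux_eq mulrDr mulr_sumr.
rewrite mulrA -pres_scal_central -mulrA xVx mulr1.
by congr (_ + _); apply: eq_bigr => k _; rewrite mulrA xVx mul1r.
Qed.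

Lemma tHyx_neq i j : i != j -> y i * x j - x j * y i = - s i j.
Proof.
move=> nij; rewrite yE mulrA xxV_comm -!mulrA -mulrBr Ux_neq //.
by rewrite mulrN mulrA xVx mul1r.
Qed.

Let UxV i j : i != j -> U i * xV j = xV j * U i + xV j * s i j.
Proof.
move=> nij; have /eqP := Ux_neq nij; rewrite subr_eq => /eqP h.
rewrite -[LHS]mul1r -(xVx j) -mulrA [x j * _]mulrA.
have -> : x j * U i = U i * x j + x i * s i j.
  by rewrite h addrAC addNr add0r.
rewrite mulrDl mulrDr -[U i * x j * _]mulrA xxV mulr1; congr (_ + _).
by rewrite -mulrA wxV tpermR [x i * _]mulrA xxV mul1r.
Qed.

Lemma tHyy i j : y i * y j = y j * y i.
Proof.
wlog ij : i j / (i < j)%N => [h|].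
  by case: (ltngtP i j) => [/h|/h->|/val_inj->].
have nij : i != j by rewrite neq_ltn ij.
have yy k l : k != l ->
    y k * y l = xV k * xV l * (U k * U l + U k * s k l).
  move=> kl; rewrite !yE mulrA -[xV k * U k * xV l]mulrA UxV // mulrDr mulrDl.
  rewrite mulrDr; congr (_ + _); first by rewrite !mulrA.
  by rewrite -!mulrA sU tpermR.
rewrite yy // yy 1?eq_sym // [xV j * _]xVxV; congr (_ * _).
apply/eqP; rewrite -subr_eq0 opprD addrACA UU // [s j i]sC -mulrBl -mulrDl.
by rewrite addrA subrK subrr mul0r.
Qed.

Definition iota_gen (g : rca_gens) : tca kappa :=
  match g with
  | inl (inl i) => x i
  | inl (inr i) => y i
  | inr w => w_ w
  end.

Fact iota_rel a b : rca_rel kappa a b ->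
  free_eval sc iota_gen a = free_eval sc iota_gen b.
Proof.
have [e1 eM] := free_eval_monoid iota_gen (@pres_scal_central _ _ (tca_rel kappa)).
have eg g : free_eval sc iota_gen (free_gen F g) = iota_gen g.
  exact: free_eval_gen.
have egg g h : free_eval sc iota_gen (free_gen F g * free_gen F h) =
  iota_gen g * iota_gen h by rewrite eM !eg.
have eC g h : free_eval sc iota_gen
    (free_gen F g * free_gen F h - free_gen F h * free_gen F g) =
  iota_gen g * iota_gen h - iota_gen h * iota_gen g.
  by rewrite -(egg g h) -(egg h g); apply: raddfB.
case=> [i j||v w|w i|i j|i i' j h|i|i j h].
- exact: etrans (egg (rca_x i) (rca_x j))
    (etrans (xx i j) (esym (egg (rca_x j) (rca_x i)))).
- by rewrite e1 eg; apply: w1.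
- by rewrite egg eg; apply: ww.
- exact: etrans (egg (rca_w w) (rca_x i))
    (etrans (wx w i) (esym (egg (rca_x (w i)) (rca_w w)))).
- exact: etrans (egg (rca_y i) (rca_y j))
    (etrans (tHyy i j) (esym (egg (rca_y j) (rca_y i)))).
- exact: etrans (egg (rca_w (tperm i i')) (rca_y j))
    (etrans (tHwy j h) (esym (egg (rca_y (tperm i i' j)) (rca_w (tperm i i'))))).
- rewrite eC; apply: etrans (tHyx_eq i) _; apply/esym.
  apply: etrans (raddfD _ _ _) _; congr (_ + _); first exact: free_eval_scal.
  by apply: etrans (raddf_sum _ _ _ _) _; apply: eq_bigr => k _; apply: eg.
- rewrite eC; apply: etrans (tHyx_neq h) _; apply/esym.
  by apply: etrans (raddfN _ _) _; congr (- _); apply: eg.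
Qed.

Definition iota : {rmorphism rca kappa -> tca kappa} :=
  pres_lift (@pres_scal_central _ _ (tca_rel kappa)) iota_rel.

Lemma iota_x i : iota (Hx kappa i) = x i.
Proof. exact: pres_lift_gen. Qed.
Lemma iota_y i : iota (Hy kappa i) = y i.
Proof. exact: pres_lift_gen. Qed.
Lemma iota_w w : iota (Hw kappa w) = w_ w.
Proof. exact: pres_lift_gen. Qed.
Lemma iota_scal c : iota (pres_scal (rca_rel kappa) c) = sc c.
Proof. exact: pres_lift_scal. Qed.
Lemma iota_u i : iota (Hu kappa i) = u i.
Proof.
rewrite /Hu rmorphD rmorphM rmorph_sum /= iota_x iota_y /tHy mulrA xxV mul1r.
by under eq_bigr do rewrite iota_w; rewrite subrK.
Qed.

End Embedding.
End CherednikAlgebras.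

Section Modules.
Context (F : fieldType) (A : pzRingType) (sc : {rmorphism F -> A}).

Definition finitely_generated (M : lmodType A) : Prop :=
  exists s : seq M, forall v, exists c : 'I_(size s) -> A,
    v = \sum_(i < size s) c i *: s`_i.

(* [W] is meant to be an F-subspace of [M], the field acting through [sc].       *)
Definition finite_dim (M : lmodType A) (W : M -> Prop) : Prop :=
  exists s : seq M, (forall v, v \in s -> W v) /\
    forall v, W v -> exists c : 'I_(size s) -> F,
      v = \sum_(i < size s) sc (c i) *: s`_i.

Context (n : nat) (u : 'I_n -> A).

(* The image of F[u_1, ..., u_n] in [A], when the [u i] commute.                 *)
Inductive subalgebra_generated : A -> Prop :=
| sag_scal c : subalgebra_generated (sc c)
| sag_gen i : subalgebra_generated (u i)
| sag_add a b : subalgebra_generated a -> subalgebra_generated b ->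
    subalgebra_generated (a + b)
| sag_mul a b : subalgebra_generated a -> subalgebra_generated b ->
    subalgebra_generated (a * b).

Definition cyclic_span (M : lmodType A) (v : M) : M -> Prop :=
  fun w => exists2 a, subalgebra_generated a & w = a *: v.

Definition weight_space (M : lmodType A) (zeta : {ffun 'I_n -> F}) (v : M) : Prop :=
  forall i, u i *: v = sc (zeta i) *: v.

End Modules.

Definition internal_direct_sum (I : eqType) (M : zmodType) (N : I -> M -> Prop) : Prop :=
  (forall v, exists (s : seq I) (f : I -> M),
     [/\ uniq s, (forall i, i \in s -> N i (f i)) & v = \sum_(i <- s) f i]) /\
  (forall (s : seq I) (f : I -> M), uniq s -> (forall i, i \in s -> N i (f i)) ->
     \sum_(i <- s) f i = 0 -> forall i, i \in s -> f i = 0).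

Section Categories.
Context (F : fieldType) (n : nat) (kappa : F).

Definition y_locally_nilpotent (M : lmodType (rca n kappa)) : Prop :=
  forall v : M, exists2 k : nat, (0 < k)%N & forall i, Hy kappa i ^+ k *: v = 0.

Definition in_O_rca (M : lmodType (rca n kappa)) : Prop :=
  finitely_generated M /\ y_locally_nilpotent M.

Definition in_O_tca (M : lmodType (tca n kappa)) : Prop :=
  finitely_generated M /\
  forall v : M, finite_dim (pres_scal (tca_rel kappa))
    (cyclic_span (pres_scal (tca_rel kappa)) (@tHu F n kappa) v).

Definition in_Oss_rca (M : lmodType (rca n kappa)) : Prop :=
  in_O_rca M /\
  internal_direct_sum
    (@weight_space F _ (pres_scal (rca_rel kappa)) n (@Hu F n kappa) M).

Definition in_Oss_tca (M : lmodType (tca n kappa)) : Prop :=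
  in_O_tca M /\
  internal_direct_sum
    (@weight_space F _ (pres_scal (tca_rel kappa)) n (@tHu F n kappa) M).

Definition induced (M : lmodType (rca n kappa)) : lmodType (tca n kappa) :=
  tensor (iota n kappa) M.

End Categories.

(* Main.v *)
Require Import Defs.
From HB Require Import structures.
From mathcomp Require Import all_boot all_fingroup all_algebra.
From mathcomp Require Import finmap boolp xfinmap monalg.

(** Write H for the rational algebra, T for the trigonometric one, X for the
    product x_1 ... x_n, and e m for the element 1 (x) m of the induced module.

    The point is that T is the localization of H at X. In H one has
    [u_i, X] = kappa X ([u_HX]), so X commutes with the u_i up to a shift; as
    every x_i^-1 equals X^-1 times the product of the other x_j, every b in T
    satisfies X^l b = iota(a) for some l and some a in H, and so every v in the
    induced module satisfies X^k v = e m for some k and m ([tca_fractional],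
    [induced_fraction]).

    If M is a sum of weight spaces, this exhibits v as a combination of the
    X^-k e m_zeta with m_zeta of weight zeta, and these are weight vectors of
    weight zeta - kappa (k, ..., k). Finitely many of them span F[u]v, because
    each of them is obtained from v by a polynomial in the u_i that separates
    the weights ([weight_projector]). Finite generation is immediate.

    The converse rests on two facts.

    - The map e is injective as soon as X is regular on M ([unit_tens_eq0]).
      Since T is known only through a presentation, this needs a T-module
      receiving M: the module M[X^-1] of fractions is built, the generators of
      T act on it, and the defining relations are verified, which amounts to
      verifying in H the relations between the x_i, the permutations and the
      u_i.

    - On a y-nilpotent module, X is regular modulo every submodule P: if X m
      lies in P then so does m ([saturated_HX]). Indeed D = y_1 + ... + y_n
      satisfies [D, x_j] = kappa, hence
        (r+1) kappa D^r m = D^(r+1) x_j m - x_j D^(r+1) m,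
      and D^r m = 0 for r large; so if x_j m is in P, descending induction puts
      every D^r m, and finally m, in P. This is where the characteristic of F
      and kappa != 0 enter.

    With P = 0 the second fact makes e injective. The weight components of e m
    are polynomials in the u_i applied to e m, so they lie in e(M) and yield a
    decomposition of m. If t_1, ..., t_r generate the induced module and
    X^(k_j) t_j = e m_j, let P be the H-submodule generated by the m_j. For
    every m some X^k e m lies in e(P), hence X^k m lies in P, and m lies in P by
    the second fact: M is generated by the m_j. *)

Set Implicit Arguments.
Unset Strict Implicit.
Unset Printing Implicit Defensive.
Import GRing.Theory Quotient.
Local Open Scope ring_scope.

(** * Linear endomorphisms *)

Section LinearEndomorphisms.
Context (F : fieldType) (V : lmodType F).

(** Scalars are central among linear endomorphisms, but not among additive ones,
    and a presented algebra maps only into rings where they are central. *)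
Record lin_endo : Type :=
  LinEndo { endo_fun :> V -> V; endo_linear : linear endo_fun }.

HB.instance Definition _ := gen_eqMixin lin_endo.
HB.instance Definition _ := gen_choiceMixin lin_endo.
HB.instance Definition _ (f : lin_endo) :=
  GRing.isLinear.Build F V V *:%R f (endo_linear f).

Lemma endo_eq (f g : lin_endo) : (forall v, f v = g v) -> f = g.
Proof.
case: f g => [f hf] [g hg] /= /funext fg; rewrite {f}fg in hf *.
by congr LinEndo; apply: Prop_irrelevance.
Qed.

Fact endo_zero_linear : linear (fun _ : V => 0 : V).
Proof. by move=> c u v; rewrite scaler0 addr0. Qed.
Fact endo_opp_linear (f : lin_endo) : linear (fun v => - f v).
Proof. by move=> c u v; rewrite linearP opprD scalerN. Qed.
Fact endo_add_linear (f g : lin_endo) : linear (fun v => f v + g v).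
Proof. by move=> c u v; rewrite !linearP scalerDr addrACA. Qed.
Fact endo_one_linear : linear (fun v : V => v).
Proof. by []. Qed.
Fact endo_mul_linear (f g : lin_endo) : linear (fun v => f (g v)).
Proof. by move=> c u v; rewrite !linearP. Qed.

Fact endo_addA :
  associative (fun f g => LinEndo (endo_add_linear f g)).
Proof. by move=> f g h; apply: endo_eq => v; apply: addrA. Qed.
Fact endo_addC :
  commutative (fun f g => LinEndo (endo_add_linear f g)).
Proof. by move=> f g; apply: endo_eq => v; apply: addrC. Qed.
Fact endo_add0 :
  left_id (LinEndo endo_zero_linear) (fun f g => LinEndo (endo_add_linear f g)).
Proof. by move=> f; apply: endo_eq => v; apply: add0r. Qed.
Fact endo_addN :
  left_inverse (LinEndo endo_zero_linear) (fun f => LinEndo (endo_opp_linear f))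
    (fun f g => LinEndo (endo_add_linear f g)).
Proof. by move=> f; apply: endo_eq => v; apply: addNr. Qed.

HB.instance Definition _ :=
  GRing.isZmodule.Build lin_endo endo_addA endo_addC endo_add0 endo_addN.

Fact endo_mulA : associative (fun f g => LinEndo (endo_mul_linear f g)).
Proof. by move=> f g h; apply: endo_eq. Qed.
Fact endo_mul1 :
  left_id (LinEndo endo_one_linear) (fun f g => LinEndo (endo_mul_linear f g)).
Proof. by move=> f; apply: endo_eq. Qed.
Fact endo_1mul :
  right_id (LinEndo endo_one_linear) (fun f g => LinEndo (endo_mul_linear f g)).
Proof. by move=> f; apply: endo_eq. Qed.
Fact endo_mulDl :
  left_distributive (fun f g => LinEndo (endo_mul_linear f g)) +%R.
Proof. by move=> f g h; apply: endo_eq. Qed.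
Fact endo_mulDr :
  right_distributive (fun f g => LinEndo (endo_mul_linear f g)) +%R.
Proof. by move=> f g h; apply: endo_eq => v; apply: (linearD f). Qed.

HB.instance Definition _ := GRing.Zmodule_isPzRing.Build lin_endo
  endo_mulA endo_mul1 endo_1mul endo_mulDl endo_mulDr.

Lemma endo_addE (f g : lin_endo) v : (f + g) v = f v + g v. Proof. by []. Qed.
Lemma endo_oppE (f : lin_endo) v : (- f) v = - f v. Proof. by []. Qed.
Lemma endo_mulE (f g : lin_endo) v : (f * g) v = f (g v). Proof. by []. Qed.
Lemma endo_oneE v : (1 : lin_endo) v = v. Proof. by []. Qed.
Lemma endo_sumE (I : Type) (r : seq I) (P : pred I) (f : I -> lin_endo) v :
  (\sum_(i <- r | P i) f i) v = \sum_(i <- r | P i) f i v.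
Proof. by elim/big_rec2: _ => // i _ g _ <-. Qed.

Fact endo_scal_linear c : linear (fun v : V => c *: v).
Proof. by move=> d u v; rewrite scalerDr !scalerA mulrC. Qed.
Definition endo_scal c : lin_endo := LinEndo (endo_scal_linear c).
Fact endo_scal_zmod : zmod_morphism endo_scal.
Proof. by move=> c d; apply: endo_eq => v; apply: scalerBl. Qed.
Fact endo_scal_monoid : monoid_morphism endo_scal.
Proof.
split; first by apply: endo_eq => v; apply: scale1r.
by move=> c d; apply: endo_eq => v; apply/esym/scalerA.
Qed.
HB.instance Definition _ :=
  GRing.isZmodMorphism.Build F lin_endo endo_scal endo_scal_zmod.
HB.instance Definition _ :=
  GRing.isMonoidMorphism.Build F lin_endo endo_scal endo_scal_monoid.

Lemma endo_scal_central c (f : lin_endo) : endo_scal c * f = f * endo_scal c.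
Proof. by apply: endo_eq => v; apply/esym/(linearZZ f). Qed.

End LinearEndomorphisms.

(** * Inverting one element on a module *)

Section Localization.
Context (F : fieldType) (A : pzRingType) (sc : {rmorphism F -> A}).
Context (sc_central : forall c a, sc c * a = a * sc c).
Context (X : A) (M : lmodType A).
Local Notation formal := {malg M[nat]}.

(** The element [mkmalgU k m] of the free sum of copies of M stands for the
    fraction X^-k m, and fractions are identified along X^-k m = X^-(k+1) X m. *)
Inductive frac_null : formal -> Prop :=
| frac_null_shift k m : frac_null (mkmalgU k m - mkmalgU k.+1 (X *: m))
| frac_null_zero : frac_null 0
| frac_null_sub t t' : frac_null t -> frac_null t' -> frac_null (t - t').

Definition frac_pred (t : formal) : bool := `[< frac_null t >].

Fact frac_pred_closed : zmod_closed (frac_pred : {pred formal}).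
Proof.
split=> [|a b]; first exact/asboolP/frac_null_zero.
by move=> /asboolP ha /asboolP hb; apply/asboolP/frac_null_sub.
Qed.
HB.instance Definition _ :=
  GRing.isZmodClosed.Build formal frac_pred frac_pred_closed.
Definition frac_closed : zmodClosed formal :=
  GRing.ZmodClosed.clone formal frac_pred _.

Definition fracs : Type := @quot formal frac_closed.
HB.instance Definition _ := GRing.Zmodule.on fracs.
HB.instance Definition _ : EqQuotient formal (@equiv formal frac_closed) fracs :=
  EqQuotient.on fracs.

Definition frac_pi : formal -> fracs := \pi_fracs%qT.
Definition frac_repr : fracs -> formal := @generic_quotient.repr _ fracs.

Lemma frac_reprK : cancel frac_repr frac_pi. Proof. exact: reprK. Qed.

Lemma frac_piP a b : frac_pi a = frac_pi b <-> frac_null (a - b).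
Proof.
rewrite (rwP eqP) /frac_pi -[_ == _]idealrBE; split; first by move/asboolP.
by move=> h; apply/asboolP.
Qed.

Fact frac_pi_zmod : zmod_morphism frac_pi.
Proof. by move=> a b; rewrite /frac_pi raddfB. Qed.
HB.instance Definition _ :=
  GRing.isZmodMorphism.Build formal fracs frac_pi frac_pi_zmod.

Definition mfrac (k : nat) (m : M) : fracs := frac_pi (mkmalgU k m).

Fact frac_zmod k : zmod_morphism (mfrac k).
Proof. by move=> m m'; rewrite /mfrac !raddfB. Qed.
HB.instance Definition _ k :=
  GRing.isZmodMorphism.Build M fracs (mfrac k) (frac_zmod k).

Lemma frac_shift k m : mfrac k.+1 (X *: m) = mfrac k m.
Proof. by apply/esym/frac_piP/frac_null_shift. Qed.

Lemma frac_shiftn j k m : mfrac (j + k) (X ^+ j *: m) = mfrac k m.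
Proof.
elim: j => [|j IHj]; first by rewrite scale1r.
by rewrite addSn exprS -scalerA frac_shift.
Qed.

Lemma fracP t : exists k m, t = mfrac k m.
Proof.
rewrite -[t]frac_reprK [frac_repr t]monalgE raddf_sum /=.
elim/big_ind: _ => [|_ _ [k [m ->]] [l [m' ->]]|k _].
- by exists 0, 0; rewrite raddf0.
- exists (l + k)%N, (X ^+ l *: m + X ^+ k *: m').
  by rewrite raddfD /= frac_shiftn addnC frac_shiftn.
- by exists k, (frac_repr t)@_k.
Qed.

Lemma fracP2 t t' : exists k m m', t = mfrac k m /\ t' = mfrac k m'.
Proof.
have [k [m ->]] := fracP t; have [l [m' ->]] := fracP t'.
exists (l + k)%N, (X ^+ l *: m), (X ^+ k *: m').
by rewrite frac_shiftn addnC frac_shiftn.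
Qed.

(** Multiplying by a common denominator X^K turns a null sum of fractions into a
    relation in M, which detects the fractions that vanish. *)
Lemma frac_null_eval t : frac_null t ->
  exists K, forall K', (K <= K')%N ->
    malg_lift (fun k => *:%R (X ^+ (K' - k)) : {additive M -> M}) t = 0.
Proof.
elim=> [k m||t1 t2 _ [K1 h1] _ [K2 h2]].
- exists k.+1 => K hK; rewrite raddfB /= !malg_liftU /= scalerA -exprSr.
  by rewrite -subSn // subSS subrr.
- by exists 0 => K _; rewrite raddf0.
- exists (maxn K1 K2) => K; rewrite geq_max => /andP[/h1 e1 /h2 e2].
  by rewrite raddfB /= e1 e2 subrr.
Qed.

Lemma frac_eq0 m : mfrac 0 m = 0 -> exists K, X ^+ K *: m = 0.
Proof.
rewrite -(raddf0 frac_pi) => /frac_piP; rewrite subr0 => /frac_null_eval[K h].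
by exists K; have := h K (leqnn K); rewrite malg_liftU /= subn0.
Qed.

(** All the operators needed send X^-k m to X^-(k+d) (a k) m; the coefficient
    [a k] may depend on k because moving an element of A past X^-k can alter it,
    as happens for the u_i. *)
Definition formal_op (d : nat) (a : nat -> A) : formal -> formal :=
  malg_lift (fun k => (mkmalgU (k + d)%N \o *:%R (a k)) : {additive M -> formal}).
HB.instance Definition _ d a := GRing.Additive.on (formal_op d a).

(** This is what makes the operator with coefficients [a] respect the
    identification X^-k m = X^-(k+1) X m. *)
Definition shift_compatible (a : nat -> A) : Prop :=
  forall k, a k.+1 * X = X * a k.

Lemma formal_opE d a k m : formal_op d a (mkmalgU k m) = mkmalgU (k + d)%N (a k *: m).
Proof. exact: malg_liftU. Qed.

Lemma formal_op_null d a t : shift_compatible a ->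
  frac_null t -> frac_null (formal_op d a t).
Proof.
move=> ha; elim=> [k m||t1 t2 _ h1 _ h2].
- rewrite raddfB /= !formal_opE scalerA ha -scalerA addSn.
  exact: frac_null_shift.
- by rewrite raddf0; apply: frac_null_zero.
- by rewrite raddfB; apply: frac_null_sub.
Qed.

Definition frac_op (d : nat) (a : nat -> A) (t : fracs) : fracs :=
  frac_pi (formal_op d a (frac_repr t)).

Lemma frac_opE d a k m : shift_compatible a ->
  frac_op d a (mfrac k m) = mfrac (k + d) (a k *: m).
Proof.
move=> ha; rewrite /mfrac -formal_opE; apply/frac_piP; rewrite -raddfB.
by apply/formal_op_null/frac_piP => //; rewrite frac_reprK.
Qed.

Lemma shift_compatible_scal c : shift_compatible (fun=> sc c).
Proof. by move=> k; apply: sc_central. Qed.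

Definition frac_scale of (forall c a, sc c * a = a * sc c) :=
  fun c => frac_op 0 (fun=> sc c).
Local Notation scale := (frac_scale sc_central).

Lemma frac_scaleE c k m : scale c (mfrac k m) = mfrac k (sc c *: m).
Proof. by rewrite /scale frac_opE ?addn0 //; apply: shift_compatible_scal. Qed.

Fact frac_scaleA a b t : scale a (scale b t) = scale (a * b) t.
Proof. by have [k [m ->]] := fracP t; rewrite !frac_scaleE scalerA rmorphM. Qed.
Fact frac_scale1 : left_id 1 scale.
Proof. by move=> t; have [k [m ->]] := fracP t; rewrite frac_scaleE rmorph1 scale1r. Qed.
Fact frac_scaleDr : right_distributive scale +%R.
Proof.
move=> c t t'; have [k [m [m' [-> ->]]]] := fracP2 t t'.
by rewrite -raddfD !frac_scaleE scalerDr raddfD.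
Qed.
Fact frac_scaleDl t : {morph scale^~ t : a b / a + b}.
Proof.
by move=> a b; have [k [m ->]] := fracP t; rewrite !frac_scaleE rmorphD scalerDl raddfD.
Qed.

(** The scalars act on fractions through their centrality in A, so the proof of
    centrality is an argument of the type, from which its module structure is
    inferred. *)
Definition localization of (forall c a, sc c * a = a * sc c) : Type := fracs.
Local Notation loc := (localization sc_central).
HB.instance Definition _ := GRing.Zmodule.on loc.
HB.instance Definition _ := GRing.Zmodule_isLmodule.Build F loc
  frac_scaleA frac_scale1 frac_scaleDr frac_scaleDl.

Fact frac_op_linear d a : shift_compatible a -> linear (frac_op d a : loc -> loc).
Proof.
move=> ha c u v; have [k [m [m' [-> ->]]]] := fracP2 u v.
rewrite [c *: _]frac_scaleE -raddfD !frac_opE // [RHS]/GRing.add /=.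
rewrite [X in _ = X + _]frac_scaleE -raddfD scalerDr !scalerA.
by rewrite sc_central.
Qed.

Definition loc_op (d : nat) (a : nat -> A) (ha : shift_compatible a) : lin_endo loc :=
  LinEndo (frac_op_linear d ha).

Lemma loc_opE d a (ha : shift_compatible a) k m :
  loc_op d ha (mfrac k m) = mfrac (k + d) (a k *: m).
Proof. exact: frac_opE. Qed.
End Localization.

(** * Induction on presented algebras *)

Section PresentedInduction.
Context (F : fieldType) (G : choiceType).
Context (R : free_algebra F G -> free_algebra F G -> Prop).

Lemma presented_ind (P : presented R -> Prop) :
  P 1 -> (forall a b, P a -> P b -> P (a + b)) ->
  (forall c a, P a -> P (pres_scal R c * a)) ->
  (forall g a, P a -> P (pres_gen R g * a)) -> forall a, P a.
Proof.
move=> P1 PD Psc Pg a; rewrite -[a]pres_reprK.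
have P0 : P 0 by rewrite -[0](mul0r 1) -(raddf0 (pres_scal R)); apply: Psc.
have Pw (w : seq G) : P (pres_pi R (mkmalgU (FMonom w) 1)).
  elim: w => [|g w IHw].
    suff -> : mkmalgU (FMonom [::]) 1 = 1 :> free_algebra F G by rewrite rmorph1.
    by rewrite -fmoneE.
  have -> : mkmalgU (FMonom (g :: w)) 1 = free_gen F g * mkmalgU (FMonom w) 1.
    by rewrite free_gen.unlock [RHS]fgmulUU mulr1 fmuE; congr mkmalgU; apply/esym/fmmulE.
  by rewrite rmorphM; apply: Pg.
rewrite [pres_repr a]monalgE raddf_sum /=; elim/big_ind: _ => // -[w] _.
set c := (pres_repr a)@_(FMonom w).
have -> : mkmalgU (FMonom w) c = c *: mkmalgU (FMonom w) 1.
  by apply/malgP => k; rewrite mcoeffZ !mcoeffU mulr_natr.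
by rewrite pres_piZ; apply: Psc.
Qed.
End PresentedInduction.

Lemma rca_ind (F : fieldType) (n : nat) (kappa : F) (P : rca n kappa -> Prop) :
  P 1 -> (forall a b, P a -> P b -> P (a + b)) ->
  (forall c a, P a -> P (pres_scal (rca_rel kappa) c * a)) ->
  (forall i a, P a -> P (Hx kappa i * a)) ->
  (forall i a, P a -> P (Hy kappa i * a)) ->
  (forall w a, P a -> P (Hw kappa w * a)) ->
  forall a, P a.
Proof.
move=> P1 PD Psc Px Py Pw; apply: presented_ind => //.
by case=> [[i|i]|w] a; [apply: Px|apply: Py|apply: Pw].
Qed.

Lemma tca_ind (F : fieldType) (n : nat) (kappa : F) (P : tca n kappa -> Prop) :
  P 1 -> (forall a b, P a -> P b -> P (a + b)) ->
  (forall c a, P a -> P (pres_scal (tca_rel kappa) c * a)) ->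
  (forall i a, P a -> P (tHx kappa i * a)) ->
  (forall i a, P a -> P (tHxV kappa i * a)) ->
  (forall i a, P a -> P (tHu kappa i * a)) ->
  (forall w a, P a -> P (tHw kappa w * a)) ->
  forall a, P a.
Proof.
move=> P1 PD Psc Px PxV Pu Pw; apply: presented_ind => //.
by case=> [[[i|i]|i]|w] a; [apply: Px|apply: PxV|apply: Pu|apply: Pw].
Qed.

(** * Relations between x, u and permutations in the rational algebra *)

Lemma comm_prod_perm (R : pzRingType) (I : eqType) (f : I -> R) :
  (forall i j, f i * f j = f j * f i) ->
  forall r1 r2, perm_eq r1 r2 -> \prod_(i <- r1) f i = \prod_(i <- r2) f i.
Proof.
move=> fC; elim=> [|a r1 IHr1] r2; first by rewrite perm_sym => /perm_nilP->.
move=> r12; have ar2 : a \in r2 by rewrite -(perm_mem r12) mem_head.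
case/splitPr: ar2 r12 => p1 p2 r12.
have /IHr1 e : perm_eq r1 (p1 ++ p2).
  by rewrite -(perm_cons a) (perm_trans r12) // -cat1s perm_catCA.
rewrite big_cons e !big_cat /= big_cons !mulrA; congr (_ * _).
by apply: (@commr_prod _ _ _ _ _ (f a)) => i _; apply: fC.
Qed.

Lemma commutatorDD (R : pzRingType) (a b c d : R) :
  (a + b) * (c + d) - (c + d) * (a + b) =
  (a * c - c * a) + (a * d - d * a) + ((b * c - c * b) + (b * d - d * b)).
Proof.
rewrite !mulrDl !mulrDr [X in _ - X]addrACA !opprD.
by rewrite [LHS]addrACA; congr (_ + _); rewrite addrACA.
Qed.

(** For i < j' and j = j'+1, the transposition (i j) is the conjugate of (i j')
    by (j' j); hence adjacent transpositions generate all of them. *)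
Lemma tperm_ind n (P : {perm 'I_n} -> Prop) :
  P 1%g -> (forall v w, P v -> P w -> P (v * w)%g) ->
  (forall i i' : 'I_n, i' = i.+1 :> nat -> P (tperm i i')) ->
  forall i j, P (tperm i j).
Proof.
move=> P1 PM Ps.
have P_lt d (i j : 'I_n) : (i + d.+1)%N = j -> P (tperm i j).
  elim: d j => [|d IHd] j hj; first by apply: Ps; rewrite -hj addn1.
  have hj' : (i + d.+1 < n)%N by rewrite -ltnS -addnS hj ltnW ?ltnS.
  pose j' : 'I_n := Ordinal hj'.
  have jj' : j = j'.+1 :> nat by rewrite -hj addnS.
  have -> : tperm i j = (tperm j' j * (tperm i j' * tperm j' j))%g.
    rewrite -[X in (X * _)%g]tpermV -conjgE tpermJ tpermL tpermD //.
      by rewrite -val_eqE /= -[X in _ != X]addn0 eqn_add2l.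
    by rewrite -val_eqE /= -hj -[X in _ != X]addn0 eqn_add2l.
  by have Pj := Ps j' j jj'; apply: (PM) => //; apply: (PM) => //; apply: IHd.
move=> i j; case: (ltngtP i j) => [ij|ji|/val_inj->]; last by rewrite tperm1.
  by apply: (P_lt (j - i.+1)%N); rewrite addnS -addSn subnKC.
by rewrite tpermC; apply: (P_lt (i - j.+1)%N); rewrite addnS -addSn subnKC.
Qed.

Section RationalRelationsIn.
Context (F : fieldType) (n : nat) (kappa : F).
Implicit Types (i j k : 'I_n) (v w : {perm 'I_n}).
Local Notation sc := (pres_scal (rca_rel kappa)).
Local Notation x := (@Hx F n kappa).
Local Notation y := (@Hy F n kappa).
Local Notation u := (@Hu F n kappa).
Local Notation w_ := (@Hw F n kappa).
Local Notation s i j := (w_ (tperm i j)).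

Lemma H_xx i j : x i * x j = x j * x i.
Proof. exact: pres_relMM (rca_xx kappa i j). Qed.
Lemma H_w1 : w_ 1%g = 1.
Proof. by rewrite /Hw /pres_gen (pres_relP (rca_w1 n kappa)) pres_pi1. Qed.
Lemma H_ww v w : w_ v * w_ w = w_ (w * v)%g.
Proof. exact: pres_relM (rca_ww kappa v w). Qed.
Lemma H_wx w i : w_ w * x i = x (w i) * w_ w.
Proof. exact: pres_relMM (rca_wx kappa w i). Qed.
Lemma H_yy i j : y i * y j = y j * y i.
Proof. exact: pres_relMM (rca_yy kappa i j). Qed.
Lemma H_yx_eq i : y i * x i - x i * y i = sc kappa + \sum_(k : 'I_n | k != i) s i k.
Proof.
rewrite (pres_relC (rca_yx_eq kappa i)); apply: etrans (pres_piD _ _ _) _.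
by congr (_ + _); apply: pres_pi_sum.
Qed.
Lemma H_yx_neq i j : i != j -> y i * x j - x j * y i = - s i j.
Proof. by move=> h; rewrite (pres_relC (rca_yx_neq kappa h)) pres_piN. Qed.

Lemma H_sy i j k : s i j * y k = y (tperm i j k) * s i j.
Proof.
move: k; apply: (tperm_ind (P := fun w => forall k, w_ w * y k = y (w k) * w_ w)).
- by move=> k; rewrite H_w1 mul1r mulr1 perm1.
- by move=> v w hv hw k; rewrite -H_ww -mulrA hv mulrA hw -mulrA permM.
- by move=> {}i i' h k; apply: pres_relMM (rca_sy kappa k h).
Qed.

Lemma H_ss i j : s i j * s i j = 1. Proof. by rewrite H_ww tperm2 H_w1. Qed.
Lemma H_sC i j : s i j = s j i. Proof. by rewrite tpermC. Qed.
Lemma H_ws w i j : w_ w * s i j = s (w i) (w j) * w_ w.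
Proof. by rewrite !H_ww -tpermJ conjgE !mulgA mulgV mul1g. Qed.

(** The element U_i = u_i - sum_(j < i) s_ji is permuted by conjugation like an
    index, unlike u_i itself; each relation for u is reduced to one for U. *)
Let U i := x i * y i.
Let B i := \sum_(j : 'I_n | (j < i)%N) s j i.
Let uE i : u i = U i + B i. Proof. by []. Qed.

Let sU i j k : s i j * U k = U (tperm i j k) * s i j.
Proof. by rewrite /U mulrA H_wx -mulrA H_sy mulrA. Qed.

Lemma H_su i i' : i' = i.+1 :> nat -> s i i' * u i = u i' * s i i' - 1.
Proof.
move=> hi; rewrite !uE mulrDr mulrDl sU tpermL -addrA; congr (_ + _).
rewrite /B (bigD1 (P := fun k : 'I_n => (k < i')%N) i) /=; last by rewrite hi.
rewrite mulrDl H_ss addrAC subrr add0r mulr_sumr mulr_suml; apply: eq_big => k.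
  by rewrite hi ltnS ltn_neqAle andbC.
move=> hk; rewrite H_ws tpermL tpermD //; apply: contraTneq hk => <-.
  by rewrite ltnn.
by rewrite -leqNgt hi.
Qed.

Lemma H_su' i i' : i' = i.+1 :> nat -> s i i' * u i' = u i * s i i' + 1.
Proof.
move=> hi; have /(congr1 (fun a => s i i' * a * s i i')) := H_su hi.
rewrite mulrA H_ss mul1r mulrBr mulr1 mulrBl H_ss -!mulrA H_ss mulr1 => ->.
by rewrite subrK.
Qed.

Lemma H_su_neq i i' j : i' = i.+1 :> nat -> j != i -> j != i' ->
  s i i' * u j = u j * s i i'.
Proof.
move=> hi ji ji'; rewrite !uE mulrDr mulrDl sU tpermD 1?eq_sym //; congr (_ + _).
rewrite mulr_sumr mulr_suml (reindex_inj (@perm_inj _ (tperm i i'))) /=.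
apply: eq_big => k; last first.
  by move=> _; rewrite H_ws tpermK [tperm i i' j]tpermD // eq_sym.
have e : (i' < j)%N = (i < j)%N.
  by rewrite -[RHS]/(i.+1 <= j)%N -hi ltn_neqAle val_eqE eq_sym ji'.
by case: tpermP => [->|->|].
Qed.

(** Both x_i x_j y_i y_j and x_j x_i y_j y_i cancel; what remains comes from
    moving y_i past x_j. *)
Let UU i j : i != j -> U i * U j - U j * U i = (U j - U i) * s i j.
Proof.
have h k l : k != l -> U k * U l = x k * x l * (y k * y l) - U k * s k l.
  move=> kl; have /eqP := H_yx_neq kl; rewrite subr_eq => /eqP e.
  rewrite /U mulrA -[x k * y k * x l]mulrA e mulrDr mulrDl mulrN mulNr.
  by rewrite -!mulrA H_sy tpermR addrC.
move=> ij; rewrite h // h 1?eq_sym // [x j * _]H_xx [y j * _]H_yy [s j i]H_sC.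
by rewrite opprB addrC addrA subrK mulrBl.
Qed.

Lemma H_uu i j : u i * u j = u j * u i.
Proof.
wlog ij : i j / (i < j)%N => [h|].
  by case: (ltngtP i j) => [/h|/h->|/val_inj->].
have nij : i != j by rewrite neq_ltn ij.
have BU : B i * U j = U j * B i.
  rewrite mulr_suml mulr_sumr; apply: eq_bigr => k ki.
  by rewrite sU tpermD // neq_ltn ?(ltn_trans ki ij).
have BB : B i * B j = B j * B i.
  rewrite mulr_suml mulr_sumr; apply: eq_bigr => k ki.
  have kj := ltn_trans ki ij.
  rewrite mulr_sumr mulr_suml (reindex_inj (@perm_inj _ (tperm k i))) /=.
  apply: eq_big => l.
    by case: tpermP => [->|->|]; rewrite ?ij ?kj.
  by move=> _; rewrite H_ws tpermK tpermD // neq_ltn ?ij ?kj.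
have UB : U i * B j - B j * U i = U i * s i j - U j * s i j.
  have -> : B j = s i j + \sum_(k : 'I_n | (k < j)%N && (k != i)) s k j.
    by rewrite /B (bigD1 i).
  rewrite mulrDr mulrDl sU tpermL opprD addrACA mulr_suml mulr_sumr.
  rewrite [X in _ + X](_ : _ = 0) ?addr0 //; apply/eqP; rewrite subr_eq0; apply/eqP.
  apply: eq_bigr => k /andP[kj ki].
  by rewrite sU tpermD // neq_ltn ij orbT.
apply/eqP; rewrite -subr_eq0 !uE commutatorDD UU // UB BU BB !subrr !addr0.
by rewrite mulrBl addrA subrK subrr.
Qed.

Let Ux_neq i j : i != j -> U i * x j - x j * U i = - (x i * s i j).
Proof.
move=> ij; rewrite /U [x j * _]mulrA [x j * x i]H_xx -!mulrA -mulrBr H_yx_neq //.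
by rewrite mulrN.
Qed.

Let Ux_eq i : U i * x i - x i * U i =
  sc kappa * x i + \sum_(k : 'I_n | k != i) x i * s i k.
Proof.
by rewrite /U -!mulrA -mulrBr H_yx_eq mulrDr mulr_sumr -pres_scal_central.
Qed.

Let BxE i j : B i * x j - x j * B i =
  \sum_(k : 'I_n | (k < i)%N) (s k i * x j - x j * s k i).
Proof. by rewrite mulr_suml mulr_sumr -sumrB. Qed.

Let uxE i j : u i * x j - x j * u i =
  (U i * x j - x j * U i) + (B i * x j - x j * B i).
Proof. by rewrite uE mulrDl mulrDr opprD addrACA. Qed.

Let sx_comm i j k : k != i -> k != j -> s i j * x k - x k * s i j = 0.
Proof. by move=> ki kj; rewrite H_wx tpermD ?subrr // eq_sym. Qed.

Lemma H_ux_lt i j : (i < j)%N -> u i * x j - x j * u i = - (x i * s i j).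
Proof.
move=> ij; rewrite uxE Ux_neq ?neq_ltn ?ij // BxE big1 ?addr0 // => k ki.
by rewrite sx_comm // neq_ltn ?ij ?(ltn_trans ki ij) ?orbT.
Qed.

Lemma H_ux_gt i j : (j < i)%N -> u i * x j - x j * u i = - (x j * s j i).
Proof.
move=> ji; rewrite uxE Ux_neq ?neq_ltn ?ji ?orbT // BxE (bigD1 j) //= big1.
  by rewrite addr0 H_wx tpermL [s i j]H_sC addrA addNr add0r.
by move=> k /andP[_ kj]; apply: sx_comm; [rewrite eq_sym|rewrite neq_ltn ji].
Qed.

Lemma H_ux_eq i : u i * x i - x i * u i =
  sc kappa * x i + \sum_(k : 'I_n | (k < i)%N) x k * s k i
    + \sum_(k : 'I_n | (i < k)%N) x i * s i k.
Proof.
rewrite uxE Ux_eq BxE (bigID (fun k : 'I_n => (k < i)%N) (fun k => k != i)) /=.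
have -> : \sum_(k : 'I_n | (k < i)%N) (s k i * x i - x i * s k i) =
    \sum_(k : 'I_n | (k < i)%N) x k * s k i
    - \sum_(k : 'I_n | (k < i)%N) x i * s i k.
  rewrite -sumrB; apply: eq_bigr => k _.
  by rewrite H_wx tpermR [s i k]H_sC.
have -> : \sum_(k : 'I_n | (k != i) && (k < i)%N) x i * s i k =
    \sum_(k : 'I_n | (k < i)%N) x i * s i k.
  by apply: eq_bigl => k; rewrite -val_eqE neq_ltn; case: ltngtP.
have -> : \sum_(k : 'I_n | (k != i) && ~~ (k < i)%N) x i * s i k =
    \sum_(k : 'I_n | (i < k)%N) x i * s i k.
  by apply: eq_bigl => k; rewrite -val_eqE neq_ltn; case: ltngtP.
by rewrite addrACA [X in _ + (X - _)]addrC addrK.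
Qed.

Definition HX : rca n kappa := \prod_i x i.
Definition HX_but i : rca n kappa := \prod_(j <- [seq j <- index_enum 'I_n | j != i]) x j.

Let prod_perm := comm_prod_perm H_xx.

Lemma HX_butE i : x i * HX_but i = HX.
Proof.
transitivity (\prod_(j <- i :: [seq j <- index_enum 'I_n | j != i]) x j).
  by rewrite big_cons.
apply: prod_perm.
apply: uniq_perm; rewrite /= ?mem_filter ?eqxx ?filter_uniq ?index_enum_uniq //.
by move=> j; rewrite in_cons mem_filter mem_index_enum andbT orbN.
Qed.

Lemma HX_x i : HX * x i = x i * HX.
Proof. by apply/esym/(@commr_prod _ _ _ _ _ (x i)) => j _; apply: H_xx. Qed.

Lemma HX_but_x i j : HX_but i * x j = x j * HX_but i.
Proof. by apply/esym/(@commr_prod _ _ _ _ _ (x j)) => k _; apply: H_xx. Qed.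

Lemma HX_HX_but i : HX * HX_but i = HX_but i * HX.
Proof.
apply/esym/(@commr_prod _ _ _ _ _ (HX_but i)) => j _.
exact: HX_but_x.
Qed.

Lemma w_HX w : w_ w * HX = HX * w_ w.
Proof.
have e r : w_ w * \prod_(i <- r) x i = (\prod_(i <- map w r) x i) * w_ w.
  elim: r => [|i r IHr]; first by rewrite !big_nil mulr1 mul1r.
  by rewrite map_cons !big_cons mulrA H_wx -!mulrA IHr.
rewrite e; congr (_ * _); apply: prod_perm; apply: uniq_perm.
- by rewrite map_inj_uniq ?index_enum_uniq //; apply: perm_inj.
- exact: index_enum_uniq.
by move=> i; rewrite mem_index_enum -[i](permKV w) map_f ?mem_index_enum.
Qed.

Let s_prod i j r : i \notin r -> j \notin r ->
  s i j * (\prod_(k <- r) x k) = (\prod_(k <- r) x k) * s i j.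
Proof.
elim: r => [|k r IHr]; first by rewrite !big_nil mulr1 mul1r.
rewrite !in_cons !negb_or !big_cons => /andP[ik ir] /andP[jk jr].
by rewrite mulrA H_wx tpermD // -!mulrA IHr.
Qed.

(** Moving y_i past the product of the other x_j replaces each factor x_j in turn
    by -s_ij; multiplying on the right by x_i puts the missing factor back, since
    s_ij x_i = x_j s_ij. *)
Let yx_prod i r : uniq r -> i \notin r ->
  (y i * (\prod_(j <- r) x j) - (\prod_(j <- r) x j) * y i) * x i =
  - \sum_(j <- r) (\prod_(k <- r) x k) * s i j.
Proof.
elim: r => [|a r IHr] /=; first by rewrite !big_nil mulr1 mul1r subrr mul0r oppr0.
case/andP=> ar r_uniq; rewrite in_cons negb_or => /andP[ia ir].
rewrite !big_cons.
have /eqP := H_yx_neq ia; rewrite subr_eq => /eqP e.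
set P := \prod_(j <- r) x j in IHr *.
have -> : y i * (x a * P) - x a * P * y i = x a * (y i * P - P * y i) - s i a * P.
  by rewrite mulrA e mulrDl mulNr mulrBr !mulrA [- _ + _]addrC addrAC.
rewrite mulrBl -[x a * _ * x i]mulrA IHr // s_prod // -[P * _ * x i]mulrA H_wx tpermL.
rewrite mulrN -opprD addrC.
congr (- (_ + _)).
  rewrite !mulrA; congr (_ * _).
  by apply/esym/(@commr_prod _ _ _ _ _ (x a)) => j _; apply: H_xx.
by rewrite mulr_sumr; apply: eq_bigr => j _; rewrite mulrA.
Qed.

(** The terms -s_ij from [yx_prod] cancel against those of [y_i, x_i], leaving
    only the kappa term: X is symmetric, so only its derivative in x_i counts. *)
Let y_xx i : y i * HX = HX * y i + sc kappa * HX_but i.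
Proof.
rewrite -(HX_butE i) -HX_but_x.
have /eqP : y i * x i = x i * y i + (sc kappa + \sum_(k : 'I_n | k != i) s i k).
  by rewrite -H_yx_eq addrC subrK.
have := @yx_prod i [seq j <- index_enum 'I_n | j != i].
rewrite -/(HX_but i) filter_uniq ?index_enum_uniq // mem_filter eqxx /=.
move=> /(_ isT isT) /eqP; rewrite mulrBl subr_eq addrC -!mulrA => /eqP e1 /eqP e2.
rewrite e1 e2 !mulrDr -pres_scal_central -addrA; congr (_ + _).
by rewrite big_filter -mulr_sumr addrK.
Qed.

Lemma u_HX i : u i * HX = HX * u i + sc kappa * HX.
Proof.
have BX : B i * HX = HX * B i.
  by rewrite mulr_suml mulr_sumr; apply: eq_bigr => k _; apply: w_HX.
rewrite uE mulrDl BX -mulrA y_xx mulrDr mulrDr [x i * (HX * _)]mulrA -HX_x -mulrA.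
rewrite [x i * (sc _ * _)]mulrA -pres_scal_central -mulrA HX_butE.
by rewrite addrAC.
Qed.
End RationalRelationsIn.

(** * Regularity of x on nilpotent modules *)

Definition locally_nilpotent (A : pzRingType) (M : lmodType A) (a : A) : Prop :=
  forall m : M, exists k, a ^+ k *: m = 0.

(** If a^p m = b^q m = 0, every term of the expansion of (a + b)^(p + q) m
    contains a^p or b^q. *)
Lemma locally_nilpotentD (A : pzRingType) (M : lmodType A) (a b : A) :
  GRing.comm a b -> locally_nilpotent M a -> locally_nilpotent M b ->
  locally_nilpotent M (a + b).
Proof.
move=> ab a_nil b_nil m; have [p ap] := a_nil m; have [q bq] := b_nil m.
have kill c k l : c ^+ k *: m = 0 -> (k <= l)%N -> c ^+ l *: m = 0.
  by move=> ck kl; rewrite -(subnK kl) exprD -scalerA ck scaler0.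
exists (p + q)%N; rewrite exprDn_comm // scaler_suml big1 // => i _.
rewrite -mulr_natl -scalerA; set t := _ *: m.
suff -> : t = 0 by rewrite scaler0.
rewrite /t; have [qi|iq] := leqP q i.
  by rewrite -scalerA (kill b q) // scaler0.
have c : GRing.comm (a ^+ (p + q - i)) (b ^+ i).
  by apply/commrX/commr_sym/commrX/commr_sym.
rewrite c -scalerA (kill a p) ?scaler0 //.
by rewrite -addnBA ?leq_addr // ltnW.
Qed.

Section Torsion.
Context (F : fieldType) (charF0 : [pchar F] =i pred0) (n : nat) (kappa : F).
Context (kappa_neq0 : kappa != 0) (M : lmodType (rca n kappa)).
Context (M_nilp : y_locally_nilpotent M).
Local Notation sc := (pres_scal (rca_rel kappa)).
Local Notation x := (@Hx F n kappa).
Local Notation y := (@Hy F n kappa).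

Let D : rca n kappa := \sum_i y i.

(** The transpositions in [y_j, x_j] cancel against the [y_i, x_j] with i != j. *)
Lemma D_x j : D * x j = x j * D + sc kappa.
Proof.
apply/eqP; rewrite addrC -subr_eq /D mulr_suml mulr_sumr -sumrB.
rewrite (bigD1 j) //= H_yx_eq -addrA -big_split /= big1 ?addr0 // => i ij.
by rewrite H_yx_neq // H_sC addrN.
Qed.

Lemma DXn_x r j : D ^+ r.+1 * x j = x j * D ^+ r.+1 + sc kappa * D ^+ r *+ r.+1.
Proof.
elim: r => [|r IHr]; first by rewrite expr0 mulr1 !expr1 D_x.
rewrite exprS -mulrA IHr mulrDr mulrA D_x mulrDl -!mulrA -!exprS -addrA.
congr (_ + _); rewrite [in RHS]mulrS; congr (_ + _).
by rewrite mulrnAr mulrA -pres_scal_central -mulrA -exprS.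
Qed.

Lemma D_nilp : locally_nilpotent M D.
Proof.
suff [//] : (forall i, GRing.comm (y i) D) /\ locally_nilpotent M D.
rewrite /D; elim/big_rec: _ => [|i b _ [bc b_nil]].
  by split=> [i|m]; [apply: commr0|exists 1; rewrite expr1 scale0r].
split=> [j|]; first by apply: commrD; [apply: H_yy|].
by apply: locally_nilpotentD => // m; have [k _ h] := M_nilp m; exists k.
Qed.

Context (N : M -> Prop) (N_add : forall m m', N m -> N m' -> N (m + m')).
Context (N_scale : forall a m, N m -> N (a *: m)).

(** Descending induction on r: D^r m = 0 for r large, and the relation
    [D^(r+1), x_j] = (r+1) kappa D^r recovers D^r m from D^(r+1) m and x_j m. *)
Lemma saturated_x j m : N (x j *: m) -> N m.
Proof.
move=> xm; have [r hr] := D_nilp m.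
have {hr}: N (D ^+ r *: m) by rewrite hr -(scale0r (x j *: m)); apply: N_scale.
elim: r => [|r IHr]; first by rewrite scale1r.
move=> Dm; apply: IHr.
have c0 : kappa * r.+1%:R != 0.
  by rewrite mulf_neq0 // ((pcharf0P F).1 charF0).
have e : sc (kappa * r.+1%:R) * D ^+ r = D ^+ r.+1 * x j + (-1) * (x j * D ^+ r.+1).
  rewrite DXn_x mulN1r addrAC subrr add0r rmorphM rmorph_nat -mulrA.
  by rewrite mulr_natl mulrnAr.
suff : N (sc (kappa * r.+1%:R)^-1 *: ((sc (kappa * r.+1%:R) * D ^+ r) *: m)).
  by rewrite scalerA mulrA -rmorphM mulVf // rmorph1 mul1r.
apply: N_scale; rewrite e scalerDl -!scalerA.
by apply: N_add; [apply: N_scale|apply/N_scale/N_scale].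
Qed.

Lemma saturated_HX k m : N (HX n kappa ^+ k *: m) -> N m.
Proof.
elim: k m => [|k IHk] m; first by rewrite scale1r.
rewrite exprSr -scalerA => /IHk; rewrite /HX.
elim: (index_enum _) => [|j r IHr]; first by rewrite big_nil scale1r.
by rewrite big_cons -scalerA => /saturated_x.
Qed.
End Torsion.

(** * The localized module over the trigonometric algebra *)

Section LocalizedAction.
Context (F : fieldType) (n : nat) (kappa : F) (M : lmodType (rca n kappa)).
Implicit Types (i j k : 'I_n) (v w : {perm 'I_n}).
Local Notation sc := (pres_scal (rca_rel kappa)).
Local Notation x := (@Hx F n kappa).
Local Notation u := (@Hu F n kappa).
Local Notation w_ := (@Hw F n kappa).
Local Notation s i j := (w_ (tperm i j)).
Local Notation X := (HX n kappa).

Let L := localization X M (@pres_scal_central _ _ (rca_rel kappa)).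

Fact compat_x i : shift_compatible X (fun=> x i).
Proof. by move=> k; rewrite HX_x. Qed.
Fact compat_xV i : shift_compatible X (fun=> HX_but kappa i).
Proof.
by move=> k; rewrite HX_HX_but.
Qed.
(** From [u_i, X] = kappa X one gets u_i X^-k = X^-k (u_i - k kappa). *)
Fact compat_u i : shift_compatible X (fun l => u i - sc (kappa *+ l)).
Proof.
move=> l; rewrite mulrBl mulrBr u_HX mulrS rmorphD mulrDl opprD.
by rewrite addrA addrK -pres_scal_central.
Qed.
Fact compat_w w : shift_compatible X (fun=> w_ w).
Proof. by move=> k; apply: w_HX. Qed.

Definition loc_gen (g : tca_gens n) : lin_endo L :=
  match g with
  | inl (inl (inl i)) => loc_op _ _ 0 (compat_x i)
  | inl (inl (inr i)) => loc_op _ _ 1 (compat_xV i)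
  | inl (inr i) => loc_op _ _ 0 (compat_u i)
  | inr w => loc_op _ _ 0 (compat_w w)
  end.

Local Notation fr k m := (mfrac X k m : L).

Lemma loc_gen_x i l m : loc_gen (tca_x i) (fr l m) = fr l (x i *: m).
Proof. by rewrite loc_opE addn0. Qed.
Lemma loc_gen_xV i l m : loc_gen (tca_xV i) (fr l m) = fr l.+1 (HX_but kappa i *: m).
Proof. by rewrite loc_opE addn1. Qed.
Lemma loc_gen_u i l m :
  loc_gen (tca_u i) (fr l m) = fr l ((u i - sc (kappa *+ l)) *: m).
Proof. by rewrite loc_opE addn0. Qed.
Lemma loc_gen_w w l m : loc_gen (tca_w w) (fr l m) = fr l (w_ w *: m).
Proof. by rewrite loc_opE addn0. Qed.

Lemma loc_eq (f g : lin_endo L) : (forall l m, f (fr l m) = g (fr l m)) -> f = g.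
Proof. by move=> fg; apply: endo_eq => t; have [l [m ->]] := fracP t. Qed.

Lemma frD l m m' : fr l m + fr l m' = fr l (m + m').
Proof. by apply/esym/(raddfD (mfrac X l)). Qed.
Lemma frN l m : - fr l m = fr l (- m).
Proof. by apply/esym/(raddfN (mfrac X l)). Qed.
Lemma fr_sum (I : Type) (r : seq I) (P : pred I) l (m : I -> M) :
  \sum_(i <- r | P i) fr l (m i) = fr l (\sum_(i <- r | P i) m i).
Proof. by apply/esym/(raddf_sum (mfrac X l)). Qed.
Lemma fr_scal c l m : endo_scal L c (fr l m) = fr l (sc c *: m).
Proof. exact: frac_scaleE. Qed.

Let locE := (endo_mulE, endo_addE, endo_oppE, endo_oneE, loc_gen_x, loc_gen_xV, loc_gen_u,
  loc_gen_w, fr_scal, frD, frN).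

Let ushift i j l : (u i - sc (kappa *+ l)) * x j - x j * (u i - sc (kappa *+ l)) =
   u i * x j - x j * u i.
Proof.
by rewrite mulrBl mulrBr pres_scal_central opprB addrA subrK.
Qed.

Let wushift i j w b l : w_ w * u i = u j * w_ w + b ->
  w_ w * (u i - sc (kappa *+ l)) = (u j - sc (kappa *+ l)) * w_ w + b.
Proof. by move=> e; rewrite mulrBr mulrBl e pres_scal_central addrAC. Qed.

Local Notation gx i := (loc_gen (tca_x i)).
Local Notation gxV i := (loc_gen (tca_xV i)).
Local Notation gu i := (loc_gen (tca_u i)).
Local Notation gw w := (loc_gen (tca_w w)).
Local Notation gs i j := (gw (tperm i j)).

Lemma loc_xx i j : gx i * gx j = gx j * gx i.
Proof. by apply: loc_eq => l m; rewrite !locE !scalerA H_xx. Qed.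
Lemma loc_wx w i : gw w * gx i = gx (w i) * gw w.
Proof. by apply: loc_eq => l m; rewrite !locE !scalerA H_wx. Qed.
Lemma loc_xxV i : gx i * gxV i = 1.
Proof. by apply: loc_eq => l m; rewrite !locE scalerA HX_butE frac_shift. Qed.
Lemma loc_xVx i : gxV i * gx i = 1.
Proof.
by apply: loc_eq => l m; rewrite !locE scalerA HX_but_x HX_butE frac_shift.
Qed.
Lemma loc_su i i' : i' = i.+1 :> nat -> gs i i' * gu i = gu i' * gs i i' - 1.
Proof.
move=> h; apply: loc_eq => l m; rewrite !locE; congr (mfrac _ _ _).
by rewrite -[X in _ = _ - X]scale1r !scalerA -scalerBl (wushift _ (H_su kappa h)).
Qed.
Lemma loc_su' i i' : i' = i.+1 :> nat -> gs i i' * gu i' = gu i * gs i i' + 1.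
Proof.
move=> h; apply: loc_eq => l m; rewrite !locE; congr (mfrac _ _ _).
by rewrite -[X in _ = _ + X]scale1r !scalerA -scalerDl (wushift _ (H_su' kappa h)).
Qed.
Lemma loc_su_neq i i' j : i' = i.+1 :> nat -> j != i -> j != i' ->
  gs i i' * gu j = gu j * gs i i'.
Proof.
move=> h ji ji'; apply: loc_eq => l m; rewrite !locE !scalerA.
by rewrite (wushift (b := 0) l (i := j) (j := j)) ?addr0 //; apply: H_su_neq.
Qed.
Let uushift i j l : (u i - sc (kappa *+ l)) * (u j - sc (kappa *+ l)) =
  (u j - sc (kappa *+ l)) * (u i - sc (kappa *+ l)).
Proof.
have c a : GRing.comm (sc (kappa *+ l)) a by apply: pres_scal_central.
have uC : GRing.comm (u i - sc (kappa *+ l)) (u j).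
  apply/commr_sym/commrB; first by rewrite /GRing.comm H_uu.
  exact/commr_sym/c.
by apply: commrB => //; apply/commr_sym/c.
Qed.

Lemma loc_uu i j : gu i * gu j = gu j * gu i.
Proof. by apply: loc_eq => l m; rewrite !locE !scalerA uushift. Qed.
Lemma loc_ux_lt i j : (i < j)%N -> gu i * gx j - gx j * gu i = - (gx i * gs i j).
Proof.
move=> h; apply: loc_eq => l m; rewrite !locE !scalerA; congr (mfrac _ _ _).
by rewrite -scalerBl ushift H_ux_lt // scaleNr.
Qed.
Lemma loc_ux_gt i j : (j < i)%N -> gu i * gx j - gx j * gu i = - (gx j * gs j i).
Proof.
move=> h; apply: loc_eq => l m; rewrite !locE !scalerA; congr (mfrac _ _ _).
by rewrite -scalerBl ushift H_ux_gt // scaleNr.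
Qed.
Let gxw_sum (P : pred 'I_n) (f : 'I_n -> 'I_n) (g : 'I_n -> {perm 'I_n}) l m :
  (\sum_(k | P k) gx (f k) * gw (g k)) (fr l m) =
  fr l ((\sum_(k | P k) x (f k) * w_ (g k)) *: m).
Proof.
rewrite endo_sumE scaler_suml -fr_sum; apply: eq_bigr => k _.
by rewrite endo_mulE loc_gen_w loc_gen_x scalerA.
Qed.

Lemma loc_ux_eq i : gu i * gx i - gx i * gu i =
  endo_scal L kappa * gx i + \sum_(k : 'I_n | (k < i)%N) gx k * gs k i
    + \sum_(k : 'I_n | (i < k)%N) gx i * gs i k.
Proof.
apply: loc_eq => l m; rewrite [RHS]endo_addE [X in _ = X + _]endo_addE.
rewrite (gxw_sum _ id (fun k => tperm k i)) (gxw_sum _ (fun=> i) (tperm i)).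
rewrite !locE !scalerA -scalerBl ushift -!scalerDl; congr (mfrac _ _ _).
by congr (_ *: _); apply: H_ux_eq.
Qed.

(** The shift by k kappa disappears from every relation, since it is central and
    each relation between the u_i, the x_j and the permutations is invariant
    under adding one scalar to all the u_i. *)
Fact loc_rel a b : tca_rel kappa a b ->
  free_eval (endo_scal L) loc_gen a = free_eval (endo_scal L) loc_gen b.
Proof.
have [e1 eM] := free_eval_monoid loc_gen (@endo_scal_central _ L).
have eg g : free_eval (endo_scal L) loc_gen (free_gen F g) = loc_gen g.
  exact: free_eval_gen.
have egg g h : free_eval (endo_scal L) loc_gen (free_gen F g * free_gen F h) =
  loc_gen g * loc_gen h by rewrite eM !eg.
have eC g h : free_eval (endo_scal L) loc_gen
    (free_gen F g * free_gen F h - free_gen F h * free_gen F g) =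
  loc_gen g * loc_gen h - loc_gen h * loc_gen g.
  by rewrite -(egg g h) -(egg h g); apply: raddfB.
case=> [i j|i|i||v w|w i|i j|i i' h|i i' h|i i' j h ji ji'|i|i j h|i j h].
- exact: etrans (egg (tca_x i) (tca_x j))
    (etrans (loc_xx i j) (esym (egg (tca_x j) (tca_x i)))).
- by rewrite egg e1; apply: loc_xxV.
- by rewrite egg e1; apply: loc_xVx.
- by rewrite e1 eg; apply: loc_eq => l m; rewrite !locE H_w1 scale1r.
- by rewrite egg eg; apply: loc_eq => l m; rewrite !locE scalerA H_ww.
- exact: etrans (egg (tca_w w) (tca_x i))
    (etrans (loc_wx w i) (esym (egg (tca_x (w i)) (tca_w w)))).
- exact: etrans (egg (tca_u i) (tca_u j))
    (etrans (loc_uu i j) (esym (egg (tca_u j) (tca_u i)))).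
- rewrite egg; apply: etrans (loc_su h) _; apply/esym.
  apply: etrans (raddfB _ _ _) _.
  by congr (_ - _); [apply: egg|apply: e1].
- rewrite egg; apply: etrans (loc_su' h) _; apply/esym.
  apply: etrans (raddfD _ _ _) _.
  by congr (_ + _); [apply: egg|apply: e1].
- exact: etrans (egg (tca_w (tperm i i')) (tca_u j))
    (etrans (loc_su_neq h ji ji') (esym (egg (tca_u j) (tca_w (tperm i i'))))).
- rewrite eC; apply: etrans (loc_ux_eq i) _; apply/esym.
  apply: etrans (raddfD _ _ _) _; congr (_ + _); last first.
    by apply: etrans (raddf_sum _ _ _ _) _; apply: eq_bigr => k _; apply: egg.
  apply: etrans (raddfD _ _ _) _; congr (_ + _); last first.
    by apply: etrans (raddf_sum _ _ _ _) _; apply: eq_bigr => k _; apply: egg.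
  rewrite -mulr_algl; apply: etrans (eM _ _) _.
  by congr (_ * _); [apply: free_eval_scal|apply: eg].
- rewrite eC; apply: etrans (loc_ux_gt h) _; apply/esym.
  by apply: etrans (raddfN _ _) _; congr (- _); apply: egg.
- rewrite eC; apply: etrans (loc_ux_lt h) _; apply/esym.
  by apply: etrans (raddfN _ _) _; congr (- _); apply: egg.
Qed.

Definition loc_act : {rmorphism tca n kappa -> lin_endo L} :=
  pres_lift (@endo_scal_central _ L) loc_rel.

End LocalizedAction.

(** Locked, so that comparing two elements of the trigonometric algebra does not
    unfold the quotient on which it is defined. *)
HB.lock Definition loc_scale (F : fieldType) (n : nat) (kappa : F)
    (M : lmodType (rca n kappa)) (b : tca n kappa)
    (t : localization (HX n kappa) M (@pres_scal_central _ _ (rca_rel kappa))) :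
  localization (HX n kappa) M (@pres_scal_central _ _ (rca_rel kappa)) :=
  loc_act M b t.

Section LocalizedModule.
Context (F : fieldType) (n : nat) (kappa : F) (M : lmodType (rca n kappa)).
Local Notation L :=
  (localization (HX n kappa) M (@pres_scal_central _ _ (rca_rel kappa))).

Lemma loc_scale1 (t : L) : loc_scale 1 t = t.
Proof. by rewrite loc_scale.unlock rmorph1. Qed.
Lemma loc_scaleDl a b (t : L) : loc_scale (a + b) t = loc_scale a t + loc_scale b t.
Proof. by rewrite loc_scale.unlock rmorphD. Qed.
Lemma loc_scaleA a b (t : L) : loc_scale (a * b) t = loc_scale a (loc_scale b t).
Proof. by rewrite loc_scale.unlock rmorphM. Qed.
Lemma loc_scaleDr b (t t' : L) : loc_scale b (t + t') = loc_scale b t + loc_scale b t'.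
Proof. by rewrite loc_scale.unlock; apply: (raddfD (loc_act M b)). Qed.
Lemma loc_scaleN a (t : L) : loc_scale (- a) t = - loc_scale a t.
Proof. by rewrite loc_scale.unlock rmorphN. Qed.
Lemma loc_scale_sum (I : finType) (P : pred I) (a : I -> tca n kappa) (t : L) :
  loc_scale (\sum_(i | P i) a i) t = \sum_(i | P i) loc_scale (a i) t.
Proof. by rewrite loc_scale.unlock rmorph_sum endo_sumE. Qed.
Lemma loc_scale_gen g (t : L) : loc_scale (pres_gen _ g) t = loc_gen M g t.
Proof.
by rewrite loc_scale.unlock; congr (endo_fun _ t); apply: pres_lift_gen.
Qed.
Lemma loc_scale_scal c (t : L) : loc_scale (pres_scal _ c) t = c *: t.
Proof.
rewrite loc_scale.unlock; transitivity (endo_scal L c t) => //.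
by congr (endo_fun _ t); apply: pres_lift_scal.
Qed.

End LocalizedModule.

(** * Weight vectors *)

Section Weights.
Context (F : fieldType) (A : pzRingType) (sc : {rmorphism F -> A}).
Context (sc_central : forall c a, sc c * a = a * sc c).
Context (n : nat) (u : 'I_n -> A) (M : lmodType A).
Local Notation weight := (@weight_space F A sc n u M).
Local Notation poly_in_u := (subalgebra_generated sc u).

Lemma weight_scale zeta c v : weight zeta v -> weight zeta (sc c *: v).
Proof. by move=> hv i; rewrite scalerA -sc_central -scalerA hv !scalerA sc_central. Qed.

(** Multivariate Lagrange interpolation: for each eta != zeta choose i with
    eta_i != zeta_i and multiply by (u_i - eta_i) / (zeta_i - eta_i). *)
Lemma weight_projector (zeta : {ffun 'I_n -> F}) (s : seq {ffun 'I_n -> F}) :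
  exists a, [/\ poly_in_u a, forall v, weight zeta v -> a *: v = v &
    forall eta v, eta \in s -> eta != zeta -> weight eta v -> a *: v = 0].
Proof.
elim: s => [|eta s [a [a_u a1 a0]]].
  by exists 1; split=> // [|v _]; rewrite ?scale1r // -(rmorph1 sc); constructor.
have [->|ne] := eqVneq eta zeta.
  exists a; split=> // eta' v; rewrite in_cons => /orP[/eqP->|]; last exact: a0.
  by rewrite eqxx.
have [i hi] : exists i, eta i != zeta i.
  apply/existsP; apply: contraNT ne => /existsPn h.
  by apply/eqP/ffunP => i; apply/eqP; have := h i; rewrite negbK.
have act eta' v : weight eta' v ->
    (u i + sc (- eta i)) *: v = sc (eta' i - eta i) *: v.
  by move=> hv; rewrite scalerDl hv -scalerDl -rmorphD.
exists (a * (sc (zeta i - eta i)^-1 * (u i + sc (- eta i)))); split.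
- do ![apply: sag_mul | apply: sag_add | constructor]; exact: a_u.
- move=> v hv; rewrite -!scalerA (act _ _ hv) [sc _ *: (sc _ *: _)]scalerA -rmorphM.
  by rewrite mulVf ?subr_eq0 1?eq_sym // rmorph1 scale1r a1.
- move=> eta' v; rewrite in_cons -!scalerA => /orP[/eqP-> _ hv|es ez hv].
    by rewrite (act _ _ hv) subrr rmorph0 scale0r !scaler0.
  rewrite (act _ _ hv) [sc _ *: (sc _ *: _)]scalerA -rmorphM (a0 eta') //.
  exact: weight_scale.
Qed.

Lemma weight_component (s : seq {ffun 'I_n -> F}) (f : {ffun 'I_n -> F} -> M) zeta :
  uniq s -> (forall eta, eta \in s -> weight eta (f eta)) -> zeta \in s ->
  exists2 a, poly_in_u a & f zeta = a *: \sum_(eta <- s) f eta.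
Proof.
move=> s_uniq fw zs; have [a [a_u a1 a0]] := weight_projector zeta s.
exists a => //; rewrite scaler_sumr (bigD1_seq zeta) //= (a1 _ (fw _ zs)) big1_seq ?addr0 //.
by move=> eta /andP[ne es]; apply: (a0 eta) => //; apply: fw.
Qed.

Lemma poly_in_u_weight a : poly_in_u a ->
  forall zeta, exists c, forall v, weight zeta v -> a *: v = sc c *: v.
Proof.
move=> a_u zeta; elim: a_u => {a} [c|i|a b _ [c hc] _ [d hd]|a b _ [c hc] _ [d hd]].
- by exists c.
- by exists (zeta i).
- by exists (c + d) => v hv; rewrite scalerDl hc // hd // -scalerDl rmorphD.
- exists (c * d) => v hv; rewrite -scalerA hd // hc; last exact: weight_scale.
  by rewrite scalerA rmorphM.
Qed.

(** Turns coefficients attached to labels into coefficients attached to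
    positions in a list, the form in which spanning is expressed. *)
Lemma reindex_map_sum (I K : Type) (V : zmodType) (act : K -> V -> V) (s : seq I)
    (f : I -> V) (c : I -> K) :
  exists c' : 'I_(size (map f s)) -> K,
    \sum_(i <- s) act (c i) (f i) =
    \sum_(j < size (map f s)) act (c' j) (map f s)`_j.
Proof.
case: s => [|x0 s].
  by exists (fun j : 'I_0 => match notF (ltn_ord j) with end); rewrite big_nil big_ord0.
exists (fun j => c (nth x0 (x0 :: s) j)).
rewrite (big_nth x0) size_map big_mkord; apply: eq_bigr => j _.
by rewrite (nth_map x0).
Qed.

Definition weight_sum (v : M) : Prop :=
  exists (s : seq {ffun 'I_n -> F}) (f : {ffun 'I_n -> F} -> M),
    [/\ uniq s, forall zeta, zeta \in s -> weight zeta (f zeta) & v = \sum_(zeta <- s) f zeta].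

Lemma weight_sum_direct : (forall v, weight_sum v) -> internal_direct_sum weight.
Proof.
move=> h; split=> // s f s_uniq fw f0 zeta zs.
by have [a _ ->] := weight_component s_uniq fw zs; rewrite f0 scaler0.
Qed.

Lemma weight_sum_finite_dim v : weight_sum v -> finite_dim sc (cyclic_span sc u v).
Proof.
move=> [s [f [s_uniq fw ->]]]; exists (map f s); split.
  by move=> _ /mapP[zeta zs ->]; have [a a_u e] := weight_component s_uniq fw zs; exists a.
move=> _ [a a_u ->]; have [c hc] := choice (poly_in_u_weight a_u).
have [c' e] := reindex_map_sum (fun k (w : M) => sc k *: w) s f c.
exists c'; rewrite -e scaler_sumr; apply: eq_big_seq => zeta zs.
by rewrite (hc _ _ (fw _ zs)).
Qed.

End Weights.

Lemma finitely_generated_family (A : pzRingType) (M : lmodType A) (I : finType) (g : I -> M) :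
  (forall v, exists c : I -> A, v = \sum_i c i *: g i) -> finitely_generated M.
Proof.
move=> h; exists (map g (enum I)) => v; have [c ->] := h v.
have [c' e] := reindex_map_sum (@GRing.scale _ M) (enum I) g c.
by exists c'; rewrite -e big_enum.
Qed.

(** * Induced modules *)

(** The part of the universal property of the tensor product that is used to
    prove that a pure tensor does not vanish. *)
Lemma tens_eq0 (A B : pzRingType) (f : {rmorphism A -> B}) (M : lmodType A)
    (V : zmodType) (phi : B -> M -> V) :
  (forall b b' m, phi (b + b') m = phi b m + phi b' m) ->
  (forall b m m', phi b (m + m') = phi b m + phi b m') ->
  (forall b a m, phi (b * f a) m = phi b (a *: m)) ->
  forall b m, tens f b m = 0 -> phi b m = 0.
Proof.
move=> phiDl phiDr phi_bal b0 m0 t0.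
have /tensor_piP : tensor_pi f (formal_tensor b0 m0) = tensor_pi f 0.
  by rewrite raddf0.
rewrite subr0.
pose Phi : {additive {malg int[(B * M)%type]} -> V} :=
  malg_lift (fun k => *~%R (phi k.1 k.2) : {additive int -> V}).
have PhiE b m : Phi (formal_tensor b m) = phi b m by apply: malg_liftU.
suff Phi0 t : tensor_null f t -> Phi t = 0 by move/Phi0; rewrite PhiE.
elim=> [b b' m|b m m'|b a m||t1 t2 _ h1 _ h2].
- by rewrite raddfB raddfD !PhiE phiDl subrr.
- by rewrite raddfB raddfD !PhiE phiDr subrr.
- by rewrite raddfB !PhiE phi_bal subrr.
- exact: raddf0.
- by rewrite raddfB h1 h2 subrr.
Qed.

Section UnitTensor.
Context (A B : pzRingType) (f : {rmorphism A -> B}) (M : lmodType A).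

Definition unit_tens (m : M) : tensor f M := tens f 1 m.
Local Notation e := unit_tens.

Fact unit_tens_zmod : zmod_morphism e.
Proof.
by move=> m m'; apply/(canRL (addrK _)); rewrite /e -[LHS]tensDr subrK.
Qed.
HB.instance Definition _ :=
  GRing.isZmodMorphism.Build M (tensor f M) unit_tens unit_tens_zmod.

Lemma tens_unit b m : tens f b m = b *: e m.
Proof. by rewrite [RHS]tensor_scale_tens mulr1. Qed.

Lemma scale_unit_tens a m : f a *: e m = e (a *: m).
Proof. by rewrite -tens_unit -[f a]mul1r tens_bal. Qed.

Lemma tensor_unit_ind (P : tensor f M -> Prop) :
  (forall b m, P (b *: e m)) -> (forall v v', P v -> P v' -> P (v - v')) ->
  forall v, P v.
Proof.
move=> Pe PB; apply: tensor_ind => // [b m|]; first by rewrite tens_unit.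
by rewrite -(subrr (0 *: e 0)); apply: PB.
Qed.

End UnitTensor.

Section Induction.
Context (F : fieldType) (n : nat) (kappa : F) (M : lmodType (rca n kappa)).
Local Notation sc := (pres_scal (rca_rel kappa)).
Local Notation tsc := (pres_scal (tca_rel kappa)).
Local Notation X := (HX n kappa).
Local Notation iota := (Defs.iota n kappa).
Local Notation N := (induced M).

Local Notation e := (unit_tens iota (M := M)).

Let L := localization X M (@pres_scal_central _ _ (rca_rel kappa)).
Local Notation fr k m := (mfrac X k m : L).

Let iotaD a b : iota (a + b) = iota a + iota b. Proof. exact: rmorphD. Qed.
Let iotaM a b : iota (a * b) = iota a * iota b. Proof. exact: rmorphM. Qed.

(** At denominator exponent 0 the shift of u_i vanishes, and x_i^-1 (x_i y_i)
    becomes X^-1 X y_i. *)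
Lemma loc_scale_y i m : loc_scale (tHy kappa i) (fr 0 m) = fr 0 (Hy kappa i *: m).
Proof.
rewrite /tHy loc_scaleA loc_scaleDl loc_scaleN loc_scale_sum.
rewrite [loc_scale (tHu _ _) _]loc_scale_gen loc_gen_u.
have -> : \sum_(j : 'I_n | (j < i)%N) loc_scale (tHw kappa (tperm j i)) (fr 0 m) =
    fr 0 ((\sum_(j : 'I_n | (j < i)%N) Hw kappa (tperm j i)) *: m).
  rewrite scaler_suml -fr_sum; apply: eq_bigr => j _.
  by rewrite [LHS]loc_scale_gen loc_gen_w.
rewrite frN frD mulr0n rmorph0 subr0 -scalerBl /Hu addrK.
rewrite [LHS]loc_scale_gen loc_gen_xV !scalerA mulrA HX_but_x HX_butE -scalerA.
exact: frac_shift.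
Qed.

Lemma loc_scale_iota a m : loc_scale (iota a) (fr 0 m) = fr 0 (a *: m).
Proof.
elim/rca_ind: a m => [|a b ha hb|c a ha|i a ha|i a ha|w a ha] m.
- by rewrite rmorph1 loc_scale1 scale1r.
- rewrite iotaD loc_scaleDl; apply: etrans (congr2 +%R (ha m) (hb m)) _.
  by rewrite frD -scalerDl.
all: rewrite iotaM loc_scaleA; apply: etrans (congr1 (loc_scale _) (ha m)) _.
all: rewrite -scalerA; move: (a *: m) => {ha}m.
- by rewrite iota_scal loc_scale_scal; apply: fr_scal.
- by rewrite iota_x [LHS]loc_scale_gen loc_gen_x.
- by rewrite iota_y loc_scale_y.
- by rewrite iota_w [LHS]loc_scale_gen loc_gen_w.
Qed.

Lemma unit_tens_eq0 m : e m = 0 -> exists k, X ^+ k *: m = 0.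
Proof.
move=> em; apply: frac_eq0; rewrite -[mfrac _ _ _]loc_scale1.
apply: (tens_eq0 (phi := fun b m' => loc_scale b (fr 0 m'))) em => [b b' m'|b m' m''|b a m'].
- exact: loc_scaleDl.
- by rewrite -frD loc_scaleDr.
- by rewrite loc_scaleA loc_scale_iota.
Qed.
End Induction.

(** * Transfer along a localization *)

Section Fractional.
Context (A B : pzRingType) (f : {rmorphism A -> B}) (X : A).

(** The left Ore condition for b, with a denominator of bounded excess: b moves to
    the right of X^-k at the cost of enlarging the denominator. *)
Definition fractional (b : B) : Prop :=
  forall k, exists l a, f X ^+ (l + k) * b = f a * f X ^+ k.

Lemma fractional_image a :
  (forall k, exists a', X ^+ k * a = a' * X ^+ k) -> fractional (f a).
Proof.
move=> ha k; have [a' e] := ha k; exists 0, a'.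
by rewrite -rmorphXn -!rmorphM e.
Qed.

Lemma fractional_comm a : X * a = a * X -> fractional (f a).
Proof.
move=> c; apply: fractional_image => k; exists a.
by apply/esym/(commrX (x := a))/esym.
Qed.

Lemma fractional_div a b : X * a = a * X -> f X * b = f a -> fractional b.
Proof.
move=> c e k; exists 1%N, a.
have c' : a * X ^+ k = X ^+ k * a by apply: commrX; apply: esym.
by rewrite add1n exprSr -mulrA e -!rmorphXn -!rmorphM c'.
Qed.

Lemma fractional1 : fractional 1.
Proof. by move=> k; exists 0, 1; rewrite rmorph1 mulr1 mul1r. Qed.

Lemma fractionalD b b' : fractional b -> fractional b' -> fractional (b + b').
Proof.
move=> hb hb' k; have [l [a e]] := hb k; have [l' [a' e']] := hb' k.
exists (l' + l)%N, (X ^+ l' * a + X ^+ l * a').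
rewrite mulrDr rmorphD mulrDl !rmorphM !rmorphXn -!mulrA -e -e' !mulrA -!exprD.
by rewrite !addnA [(l + l')%N]addnC.
Qed.

Lemma fractionalM b b' : fractional b -> fractional b' -> fractional (b * b').
Proof.
move=> hb hb' k; have [l [a e]] := hb' k; have [l' [a' e']] := hb (l + k)%N.
by exists (l' + l)%N, (a' * a); rewrite -addnA mulrA e' -mulrA e mulrA rmorphM.
Qed.

End Fractional.

Section Fractions.
Context (A B : pzRingType) (f : {rmorphism A -> B}) (M : lmodType A) (N : lmodType B).
Context (e : {additive M -> N}) (f_scale : forall a m, f a *: e m = e (a *: m)).
Context (X : A) (P : M -> Prop).
Context (P_add : forall m m', P m -> P m' -> P (m + m')).
Context (P_scale : forall a m, P m -> P (a *: m)).

(** Keeping track of a submodule P of numerators makes the same lemmas serve for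
    the whole module and for the submodule spanned by chosen numerators. *)
Definition fraction (v : N) : Prop :=
  exists k m, P m /\ f X ^+ k *: v = e m.

Lemma fraction_unit m : P m -> fraction (e m).
Proof. by move=> Pm; exists 0, m; rewrite scale1r. Qed.

Lemma fractionD v v' : fraction v -> fraction v' -> fraction (v + v').
Proof.
move=> [k [m [Pm vm]]] [k' [m' [Pm' vm']]].
exists (k' + k)%N, (X ^+ k' *: m + X ^+ k *: m').
split; first by apply: P_add; apply: P_scale.
rewrite scalerDr {1}exprD -scalerA vm addnC exprD -scalerA vm'.
by rewrite raddfD /= -!f_scale !rmorphXn.
Qed.

Lemma fraction_scale b v :
  fractional f X b -> fraction v -> fraction (b *: v).
Proof.
move=> hb [k [m [Pm vm]]]; have [l [a e_lk]] := hb k.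
exists (l + k)%N, (a *: m); split; first exact: P_scale.
by rewrite scalerA e_lk -scalerA vm f_scale.
Qed.

End Fractions.

(** The setting is a ring morphism A -> B inverting X, a module N over B
    for which the fractions with denominators X^k and numerators in M exhaust N, and
    a family u in A with u_i X = X u_i + kappa X. *)
Section LocalizationTransfer.
Context (F : fieldType) (A B : pzRingType) (f : {rmorphism A -> B}).
Context (scA : {rmorphism F -> A}) (scB : {rmorphism F -> B}).
Context (scA_central : forall c a, scA c * a = a * scA c).
Context (scB_central : forall c b, scB c * b = b * scB c).
Context (f_sc : forall c, f (scA c) = scB c).
Context (n : nat) (u : 'I_n -> A) (uB : 'I_n -> B) (f_u : forall i, f (u i) = uB i).
Context (X : A) (Q : B) (QX : Q * f X = 1) (XQ : f X * Q = 1).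
Context (kappa : F).
Context (Xu : forall k i, X ^+ k * u i = (u i - scA (kappa *+ k)) * X ^+ k).
Context (M : lmodType A).
Context (b_fractional : forall b, fractional f X b).
Context (N : lmodType B) (e : {additive M -> N}).
Context (f_scale : forall a m, f a *: e m = e (a *: m)).
Context (N_ind : forall P : N -> Prop, (forall b m, P (b *: e m)) ->
  (forall v v', P v -> P v' -> P (v - v')) -> forall v, P v).
Local Notation weight := (weight_space scA u (M := M)).
Local Notation weightN := (weight_space scB uB (M := N)).

Lemma induced_fraction (v : N) : exists k m, f X ^+ k *: v = e m.
Proof.
suff [k [m [_ h]]] : fraction f e X (fun=> True) v by exists k, m.
apply: N_ind v => [b m|v v' hv hv'].
- by apply: fraction_scale => //; apply: fraction_unit.
- by apply: fractionD => //; rewrite -scaleN1r; apply: fraction_scale.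
Qed.

Lemma QXn k : Q ^+ k * f X ^+ k = 1.
Proof.
elim: k => [|k IHk]; first by rewrite mulr1.
by rewrite exprSr exprS -mulrA [Q * _]mulrA QX mul1r.
Qed.

Lemma XQn k : f X ^+ k * Q ^+ k = 1.
Proof.
elim: k => [|k IHk]; first by rewrite mulr1.
by rewrite exprSr exprS -mulrA [f X * _]mulrA XQ mul1r.
Qed.

Lemma fX_inj k (v v' : N) : f X ^+ k *: v = f X ^+ k *: v' -> v = v'.
Proof. by move=> /(congr1 ( *:%R (Q ^+ k))); rewrite !scalerA QXn !scale1r. Qed.

Lemma unit_weight zeta m : weight zeta m -> weightN zeta (e m).
Proof. by move=> hm i; rewrite -f_u f_scale hm -f_sc f_scale. Qed.

Definition weight_translate (c : F) (zeta : {ffun 'I_n -> F}) : {ffun 'I_n -> F} :=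
  [ffun i => zeta i + c].

Lemma weight_translateK c : cancel (weight_translate c) (weight_translate (- c)).
Proof. by move=> zeta; apply/ffunP => i; rewrite !ffunE addrK. Qed.

(** X^k u_i = (u_i - k kappa) X^k, and X^k is injective on N. *)
Lemma weight_of_fraction k zeta v : weightN zeta (f X ^+ k *: v) ->
  weightN (weight_translate (- (kappa *+ k)) zeta) v.
Proof.
move=> hv i; apply: (@fX_inj k).
have fXu : f X ^+ k * uB i = (uB i - scB (kappa *+ k)) * f X ^+ k.
  by rewrite -f_u -rmorphXn -rmorphM Xu rmorphM rmorphB f_sc rmorphXn.
rewrite scalerA fXu -scalerA scalerBl hv -scalerBl -rmorphB.
by rewrite ffunE !scalerA scB_central.
Qed.

Lemma weight_sum_induced : (forall m, weight_sum scA u (m : M)) ->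
  forall v, weight_sum scB uB (v : N).
Proof.
move=> h v; have [k [m vm]] := induced_fraction v.
have [s [g [s_uniq gw m_sum]]] := h m.
pose c := - (kappa *+ k).
exists (map (weight_translate c) s),
  (fun eta => Q ^+ k *: e (g (weight_translate (- c) eta))); split.
- by rewrite map_inj_uniq //; apply: can_inj (weight_translateK c).
- move=> _ /mapP[zeta zs ->]; rewrite weight_translateK; apply: weight_of_fraction.
  by rewrite scalerA XQn scale1r; apply/unit_weight/gw.
- apply: (@fX_inj k); rewrite vm m_sum raddf_sum big_map scaler_sumr.
  by apply: eq_bigr => zeta _; rewrite weight_translateK scalerA XQn scale1r.
Qed.

Lemma finitely_generated_induced : finitely_generated M -> finitely_generated N.
Proof.
move=> [s hs].
apply: (finitely_generated_family (g := fun i : 'I_(size s) => e s`_i)) => v.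
move: v; apply: N_ind => [b m|v v' [c ->] [c' ->]].
- have [a ->] := hs m; exists (fun i => b * f (a i)).
  rewrite raddf_sum scaler_sumr; apply: eq_bigr => i _.
  by rewrite -f_scale scalerA.
- exists (fun i => c i - c' i); rewrite -sumrB; apply: eq_bigr => i _.
  by rewrite scalerBl.
Qed.

Context (saturated : forall P : M -> Prop,
  (forall m m', P m -> P m' -> P (m + m')) -> (forall a m, P m -> P (a *: m)) ->
  forall k m, P (X ^+ k *: m) -> P m).
Context (ker_torsion : forall m, e m = 0 -> exists k, X ^+ k *: m = 0).

(** An element killed by a power of X is zero, by saturation of the zero
    submodule. *)
Lemma unit_inj : injective e.
Proof.
move=> m m' /eqP; rewrite -subr_eq0 -raddfB => /eqP/ker_torsion[k hk].
apply/eqP; rewrite -subr_eq0; apply/eqP.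
by apply: (saturated (P := fun m => m = 0)) hk => [_ _ -> ->|a _ ->];
  rewrite ?addr0 ?scaler0.
Qed.

Lemma poly_in_u_image b : subalgebra_generated scB uB b ->
  exists a, b = f a.
Proof.
elim=> [c|i|b1 b2 _ [a1 ->] _ [a2 ->]|b1 b2 _ [a1 ->] _ [a2 ->]].
- by exists (scA c).
- by exists (u i); rewrite f_u.
- by exists (a1 + a2); rewrite rmorphD.
- by exists (a1 * a2); rewrite rmorphM.
Qed.

(** The weight components of e m are polynomials in the u_i applied to e m, hence
    they lie in the image of e. *)
Lemma weight_sum_restrict : (forall v, weight_sum scB uB (v : N)) ->
  forall m, weight_sum scA u (m : M).
Proof.
move=> h m; have [s [g [s_uniq gw m_sum]]] := h (e m).
have lift zeta : exists m', zeta \in s -> g zeta = e m'.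
  have [zs|_] := boolP (zeta \in s); last by exists 0.
  have [b /poly_in_u_image[a ->] g_eq] := weight_component scB_central s_uniq gw zs.
  by exists (a *: m) => _; rewrite g_eq -m_sum f_scale.
have [g' hg'] := choice lift.
exists s, g'; split=> // [zeta zs i|].
  apply: unit_inj; rewrite -!f_scale -hg' // f_sc f_u.
  exact: gw.
apply: unit_inj; rewrite raddf_sum m_sum; apply: eq_big_seq => zeta zs.
exact: hg'.
Qed.

(** The numerators of generators of N generate a submodule P whose fractions
    fill N; so for every m some X^k m is in P, and saturation applies. *)
Lemma finitely_generated_restrict : finitely_generated N -> finitely_generated M.
Proof.
move=> [s hs].
have frac_s (j : 'I_(size s)) : exists km, f X ^+ km.1 *: s`_j = e km.2.
  by have [k [m h]] := induced_fraction s`_j; exists (k, m).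
have [km hkm] := choice frac_s.
pose P m := exists c : 'I_(size s) -> A, m = \sum_j c j *: (km j).2.
have P_add m m' : P m -> P m' -> P (m + m').
  move=> [c ->] [c' ->]; exists (fun j => c j + c' j).
  by rewrite -big_split; apply: eq_bigr => j _; rewrite scalerDl.
have P_scale a m : P m -> P (a *: m).
  move=> [c ->]; exists (fun j => a * c j).
  by rewrite scaler_sumr; apply: eq_bigr => j _; rewrite scalerA.
have P_gen j : P (km j).2.
  exists (fun i => (i == j)%:R); rewrite (bigD1 j) //= eqxx scale1r big1 ?addr0 //.
  by move=> i /negPf->; rewrite scale0r.
apply: (finitely_generated_family (g := fun j => (km j).2)) => m.
have [c em] := hs (e m).
have [k [m' [Pm' /esym]]] : fraction f e X P (e m).
  rewrite em; apply: (big_ind (fraction f e X P)).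
  - rewrite -(raddf0 e); apply: fraction_unit.
    by exists (fun=> 0); rewrite big1 // => j _; rewrite scale0r.
  - exact: fractionD.
  - move=> j _; rewrite -[s`_j]scale1r -(QXn (km j).1) -scalerA hkm scalerA.
    by apply: fraction_scale => //; apply: fraction_unit.
rewrite -rmorphXn f_scale => /unit_inj Xm.
by apply: (saturated P_add P_scale (k := k)); rewrite -Xm.
Qed.

End LocalizationTransfer.

(** * The embedding as a localization *)

Section Fractions.
Context (F : fieldType) (n : nat) (kappa : F).
Local Notation sc := (pres_scal (rca_rel kappa)).
Local Notation tsc := (pres_scal (tca_rel kappa)).
Local Notation iota := (Defs.iota n kappa).
Local Notation X := (HX n kappa).

Lemma HXn_u k i :
  X ^+ k * Hu kappa i = (Hu kappa i - sc (kappa *+ k)) * X ^+ k.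
Proof.
elim: k => [|k IHk]; first by rewrite !expr0 mulr1 mul1r mulr0n rmorph0 subr0.
by rewrite exprS -mulrA IHk mulrA -(compat_u kappa i) -mulrA.
Qed.

Lemma HX_inv : exists Q, Q * iota X = 1 /\ iota X * Q = 1.
Proof.
have xxV i : tHx kappa i * tHxV kappa i = 1.
  by rewrite (pres_relM (tca_xxV kappa i)) pres_pi1.
have xVx i : tHxV kappa i * tHx kappa i = 1.
  by rewrite (pres_relM (tca_xVx kappa i)) pres_pi1.
rewrite /HX; elim: (index_enum _) => [|i r [Q [QX XQ]]].
  by exists 1; rewrite big_nil rmorph1 mul1r.
exists (Q * tHxV kappa i); rewrite big_cons rmorphM iota_x; split.
  by rewrite -mulrA [tHxV kappa i * _]mulrA xVx mul1r.
by rewrite -mulrA [iota _ * _]mulrA XQ mul1r xxV.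
Qed.

Lemma HX_xV i : iota X * tHxV kappa i = iota (HX_but kappa i).
Proof.
rewrite -(HX_butE kappa i) -HX_but_x rmorphM iota_x -mulrA.
by rewrite (pres_relM (tca_xxV kappa i)) pres_pi1 mulr1.
Qed.

Lemma tca_fractional b : fractional iota X b.
Proof.
have fM := @fractionalM _ _ iota X.
elim/tca_ind: b => [|b b' hb hb'|c b|i b|i b|i b|w b].
- exact: fractional1.
- exact: fractionalD.
- rewrite -iota_scal; apply: fM; apply: fractional_comm.
  by rewrite pres_scal_central.
- by rewrite -iota_x; apply: fM; apply: fractional_comm; apply: HX_x.
- apply: fM; apply: (fractional_div (a := HX_but kappa i)); last exact: HX_xV.
  exact: HX_HX_but.
- rewrite -iota_u; apply: fM; apply: fractional_image => k.
  by exists (Hu kappa i - sc (kappa *+ k)); apply: HXn_u.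
- rewrite -iota_w; apply: fM; apply: fractional_comm.
  by rewrite w_HX.
Qed.
End Fractions.

Theorem proposition7p1 (F : closedFieldType) (charF0 : [pchar F] =i pred0)
    (n : nat) (n_ge2 : (2 <= n)%N) (kappa : F) (kappa_neq0 : kappa != 0)
    (M : lmodType (rca n kappa)) (M_nilp : y_locally_nilpotent M) :
  in_Oss_rca M <-> in_Oss_tca (induced M).
Proof.
pose f := Defs.iota n kappa; pose X := HX n kappa.
have [Q [QX XQ]] := @HX_inv F n kappa.
pose e : {additive M -> induced M} := unit_tens f (M := M).
have f_scale a m : f a *: e m = e (a *: m) by exact: scale_unit_tens.
have N_ind (P : induced M -> Prop) : (forall b m, P (b *: e m)) ->
    (forall v v', P v -> P v' -> P (v - v')) -> forall v, P v.
  exact: tensor_unit_ind.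
have saturated (P : M -> Prop) : (forall m m', P m -> P m' -> P (m + m')) ->
    (forall a m, P m -> P (a *: m)) -> forall k m, P (X ^+ k *: m) -> P m.
  by move=> P_add P_scale k m; apply: saturated_HX.
have ker_torsion m : e m = 0 -> exists k, X ^+ k *: m = 0.
  exact: unit_tens_eq0.
split.
- move=> [[M_fg _] [M_sum _]].
  have N_sum := weight_sum_induced (@pres_scal_central _ _ _)
    (@iota_scal _ _ _) (@iota_u _ _ _) QX XQ (@HXn_u _ _ _)
    (@tca_fractional _ _ _) f_scale N_ind M_sum.
  split; [split|].
  + exact: finitely_generated_induced f_scale N_ind M_fg.
  + by move=> v; apply: weight_sum_finite_dim => //; apply: pres_scal_central.
  + by apply: weight_sum_direct => //; apply: pres_scal_central.
- move=> [[N_fg _] [N_sum _]]; split; [split=> //|].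
  + exact: (finitely_generated_restrict QX (@tca_fractional _ _ _) f_scale
      N_ind saturated ker_torsion N_fg).
  + apply: weight_sum_direct; first exact: pres_scal_central.
    exact: (weight_sum_restrict (@pres_scal_central _ _ _) (@iota_scal _ _ _)
      (@iota_u _ _ _) f_scale saturated ker_torsion N_sum).
Qed.
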